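(* Let $q=p^e$ be an odd prime power with $q\equiv 2\pmod 3$, and let $3\le k\le e+2$. Let $g_i(X)=X^3$ and $f_i(X)=X^{p^{i-2}}$ for each $3\le i\le k$. Then $S(k,q)=S(k,q;f_3,g_3,\ldots,f_k,g_k)$ is connected and $$\lambda_2(S(k,q))\le\max\{q(p^{k-3}-1),\,(q-1)M_q\},$$ where $M_q=\max_{a,b\in\mathbb{F}_q^*}\varepsilon_{ax^3+bx}$, and moreover $M_q\le2\sqrt q$.
   Context: For a prime power $q$, integer $k\ge3$, and polynomials $f_i,g_i\in\mathbb{F}_q[X]$ ($3\le i\le k$) of degree at most $q-1$ with $g_i(-X)=-g_i(X)$, the graph $S(k,q;f_3,g_3,\ldots,f_k,g_k)$ is the simple graph with vertex set $\mathbb{F}_q^k$ in which $a=(a_1,\ldots,a_k)$ and $b=(b_1,\ldots,b_k)$ are adjacent iff $a_1\ne b_1$ and $b_i-a_i=g_i(b_1-a_1)\,f_i\!\left(\frac{b_2-a_2}{b_1-a_1}\right)$ for all $3\le i\le k$. $\lambda_2$ is the second largest adjacency eigenvalue. With $q=p^e$, $Tr(\alpha)=\alpha+\alpha^p+\cdots+\alpha^{p^{e-1}}\in\mathbb{F}_p$, $\zeta_p=\exp(2\pi i/p)$, and $\zeta_p^\beta$ for $\beta\in\mathbb{F}_p$ means $\zeta_p^{\beta^*}$ with $\beta^*\in\{0,\ldots,p-1\}$ the representative of $\beta$. For $f\in\mathbb{F}_q[X]$, the exponential sum is $\varepsilon_f=\sum_{x\in\mathbb{F}_q}\zeta_p^{Tr(f(x))}$.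 *)

(* Defs.v *)
From HB Require Import structures.
From mathcomp Require Import all_boot all_order all_algebra all_field.
Set Implicit Arguments. Unset Strict Implicit. Unset Printing Implicit Defensive.
Import Order.TTheory GRing.Theory Num.Theory.
Local Open Scope ring_scope.

Section Defs.
Variable F : finFieldType.

(* Vertices of S(k,q;...) : F_q^k as k-tuples; paper coordinate a_i is a`_(i-1). *)
(* f, g are indexed by the paper's index i (only 3 <= i <= k is used). *)
Definition S_adj (k : nat) (f g : nat -> {poly F}) : rel (k.-tuple F) :=
  fun a b =>
    (a`_0 != b`_0) &&
    [forall i : 'I_k, (2 <= i)%N ==>
       (b`_i - a`_i ==
          (g i.+1).[b`_0 - a`_0] * (f i.+1).[(b`_1 - a`_1) / (b`_0 - a`_0)])].

Definition adj_mx (T : finType) (e : rel T) : 'M[algC]_#|T| :=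
  \matrix_(i, j) ((e (enum_val i) (enum_val j))%:R : algC).
End Defs.

Definition eigvals (n : nat) (A : 'M[algC]_n) : seq algC :=
  sort (fun x y : algC => y <= x) (sval (closed_field_poly_normal (char_poly A))).

Definition lambda2 (n : nat) (A : 'M[algC]_n) : algC := nth 0 (eigvals A) 1.

Definition Tr (F : finFieldType) (p e : nat) (x : F) : F :=
  \sum_(j < e) x ^+ (p ^ j).

Definition Fp_rep (F : finFieldType) (p : nat) (b : F) : nat :=
  odflt 0%N (omap (@nat_of_ord p) [pick n : 'I_p | (n%:R : F) == b]).

(* zeta_p = exp(2 pi i / p): p.-root(-1) is exp(i pi / p) (minimal argument) *)
Definition zeta (p : nat) : algC := (p.-root (-1)) ^+ 2.

Definition expsum (F : finFieldType) (p e : nat) (f : {poly F}) : algC :=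
  \sum_(x : F) zeta p ^+ Fp_rep p (Tr p e f.[x]).

Definition Mq (F : finFieldType) (p e : nat) : algC :=
  \big[Num.max/expsum p e ('X^3 + 'X : {poly F})]_(a : F | a != 0)
    \big[Num.max/expsum p e ('X^3 + 'X : {poly F})]_(b : F | b != 0)
       expsum p e (a *: 'X^3 + b *: 'X).

(* Main.v *)
Require Import Defs.
From HB Require Import structures.
From mathcomp Require Import all_boot all_order all_algebra all_field.
From mathcomp Require Import ring zify.
Set Implicit Arguments. Unset Strict Implicit. Unset Printing Implicit Defensive.
Import Order.TTheory GRing.Theory Num.Theory.
Local Open Scope ring_scope.

(** S(k,q) is a Cayley graph of F_q^k whose connection set is parametrised by
    u != 0 and w; summing the character of parameter c over u first gives the
    eigenvalue sum_w (eps_{A(w),B(w)} - 1), where eps_{a,b} is the exponential sum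
    of a x^3 + b x, B(w) = c_1 + c_2 w, and A(w) = sum_i c_i w^(p^(i-2)).  Cubing
    is bijective on F_q, so eps_{a,b} vanishes when exactly one of a, b does, and
    the eigenvalue bound comes from counting the zeros of A and B.  Connectedness
    holds because only c = 0 attains the degree q(q-1).

    For eps <= 2 sqrt q, let S be a cubic sum over F_q.  The corresponding sum over
    F_{q^2} is 2q - S^2, so D = S^2 - 4q turns into (D + 4q) D: if D > 0, then D/q
    grows at least like 4^n along the tower F_{q^(2^n)}.  This contradicts a bound
    |S| <= 6 p sqrt q with constant independent of q, which follows from Bombieri's
    version of Stepanov's method on the curves y^p - y = a x^3 + b x + c. *)

(** * Weighted degrees of bivariate polynomials *)

Section WeightedDegree.
Variables (K : fieldType) (p : nat).
Implicit Types (g h : {poly {poly K}}).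

(* Weighted degree on K[x][y], with x of weight p and y of weight 3. *)
Definition wdeg_lt (n : nat) g :=
  forall i j : nat, (n <= p * i + 3 * j)%N -> g`_j`_i = 0.

Lemma wdeg_lt0 n : wdeg_lt n 0.
Proof. by move=> i j _; rewrite !coef0. Qed.

Lemma wdeg_ltW n m g : (n <= m)%N -> wdeg_lt n g -> wdeg_lt m g.
Proof. by move=> nm gn i j mij; apply: gn; apply: leq_trans mij. Qed.

Lemma wdeg_ltD n g h : wdeg_lt n g -> wdeg_lt n h -> wdeg_lt n (g + h).
Proof. by move=> gn hn i j nij; rewrite !coefD gn // hn // addr0. Qed.

Lemma wdeg_ltN n g : wdeg_lt n g -> wdeg_lt n (- g).
Proof. by move=> gn i j nij; rewrite !coefN gn // oppr0. Qed.

Lemma wdeg_lt_sum n (I : Type) (s : seq I) (P : pred I) (G : I -> {poly {poly K}}) :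
  (forall i, P i -> wdeg_lt n (G i)) -> wdeg_lt n (\sum_(i <- s | P i) G i).
Proof. by move=> Gn; elim/big_ind: _ => //; [apply: wdeg_lt0 | apply: wdeg_ltD]. Qed.

Lemma wdeg_ltM n m g h :
  wdeg_lt n.+1 g -> wdeg_lt m h -> wdeg_lt (n + m) (g * h).
Proof.
move=> gn hm i j nmij; rewrite coefM coef_sum big1 // => -[k kj] _ /=.
rewrite coefM big1 // => -[l li] _ /=.
have [nkl|] := leqP n.+1 (p * l + 3 * k); first by rewrite gn // mul0r.
rewrite ltnS => nkl; rewrite (hm (i - l)%N (j - k)%N) ?mulr0 //.
have : (p * i = p * l + p * (i - l))%N by rewrite -mulnDr subnKC.
lia.
Qed.

Lemma wdeg_ltMr n m g h :
  wdeg_lt n g -> wdeg_lt m.+1 h -> wdeg_lt (n + m) (g * h).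
Proof. by move=> gn hm; rewrite addnC mulrC; apply: wdeg_ltM. Qed.

Lemma wdeg_ltMS n m g h :
  wdeg_lt n.+1 g -> wdeg_lt m.+1 h -> wdeg_lt (n + m).+1 (g * h).
Proof. by move=> gn hm; rewrite -addnS; apply: wdeg_ltM. Qed.

Lemma wdeg_lt1 : wdeg_lt 1 1.
Proof.
move=> i j h; rewrite coef1; case: j h => [|j] h /=; last by rewrite coef0.
rewrite coef1; case: i h => //=; lia.
Qed.

Lemma wdeg_ltX n g k : wdeg_lt n.+1 g -> wdeg_lt (k * n).+1 (g ^+ k).
Proof.
move=> gn; elim: k => [|k IH]; first exact: wdeg_lt1.
by rewrite exprS mulSn; apply: wdeg_ltMS.
Qed.

Lemma wdeg_ltY : wdeg_lt 4 'X.
Proof.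
move=> i j h; rewrite coefX; case: eqP => [jE|_]; last by rewrite coef0.
by rewrite coef1; case: i h => //=; lia.
Qed.

Lemma wdeg_ltC n (f : {poly K}) : (p * (size f) <= n + p)%N ->
  (0 < p)%N -> wdeg_lt n.+1 f%:P.
Proof.
move=> fn p0 i j h; rewrite coefC; case: eqP => [jE|_]; last by rewrite coef0.
have {jE}h : (n < p * i)%N by move: h; rewrite jE muln0 addn0.
by apply: nth_default; move: (size _) fn => s fn; nia.
Qed.

Lemma wdeg_ltXn i : (0 < p)%N -> wdeg_lt (p * i).+1 ('X^i)%:P.
Proof. by move=> p0; apply: wdeg_ltC => //; rewrite size_polyXn; lia. Qed.

Lemma wdeg_ltZ (c : K) n g : wdeg_lt n g -> wdeg_lt n (c%:P *: g).
Proof. by move=> gn i j h; rewrite coefZ coefCM gn // mulr0. Qed.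

End WeightedDegree.

(** * Reduction modulo an Artin-Schreier polynomial *)

Section ArtinSchreier.
Import Pdiv.CommonRing Pdiv.RingMonic.
Variables (K : fieldType) (p : nat) (f : {poly K}).
Hypotheses (p1 : (1 < p)%N) (sf : (size f <= 4)%N).

(** The curve y^p - y = f(x), with y as the outer variable. For f of degree 3 and p prime to 3, the
    weights p and 3 are the pole orders of x and y at infinity. *)
Definition AS_poly : {poly {poly K}} := 'X^p - ('X + f%:P).

Let szr : (size ('X + f%:P : {poly {poly K}})%R < p.+1)%N.
Proof. by rewrite size_XaddC ltnS. Qed.

Lemma size_AS_poly : size AS_poly = p.+1.
Proof. by rewrite /AS_poly size_polyDl size_polyXn // size_polyN. Qed.

Lemma monic_AS_poly : AS_poly \is monic.
Proof.
rewrite monicE /AS_poly lead_coefDl ?lead_coefXn // size_polyN size_polyXn.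
exact: szr.
Qed.

Lemma wdeg_AS_poly : wdeg_lt p (3 * p).+1 AS_poly.
Proof.
apply: wdeg_ltD.
  by rewrite mulnC; apply: wdeg_ltX; apply: wdeg_ltY.
apply/wdeg_ltN/wdeg_ltD; first by apply: wdeg_ltW (@wdeg_ltY _ _); lia.
by apply: wdeg_ltC; [nia | lia].
Qed.

(** A division step trades y^d for y^(d-p) times y + f. Neither y nor f weighs more than y^p, that
    is 3p, so the weight does not increase; induction is on the degree in y. *)
Lemma wdeg_lt_rmodp n g : wdeg_lt p n g -> wdeg_lt p n (rmodp g AS_poly).
Proof.
have [m] := ubnP (size g); elim: m g => // m IH g /ltnSE gm gn.
have [gp|pg] := ltnP (size g) (size AS_poly); first by rewrite rmodp_small.
rewrite size_AS_poly in pg.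
set d := (size g).-1; have dE : size g = d.+1 by rewrite prednK //; lia.
set q := (lead_coef g)%:P * 'X^(d - p).
have -> : rmodp g AS_poly = rmodp (g - q * AS_poly) AS_poly.
  by rewrite rmodpB ?monic_AS_poly // rmodp_mull ?monic_AS_poly // subr0.
have g0 : g != 0 by rewrite -size_poly_gt0 dE.
have lc0 : lead_coef g != 0 by rewrite lead_coef_eq0.
have szq : size (q * AS_poly) = size g.
  rewrite size_Mmonic ?monic_AS_poly //; last first.
    by rewrite mulf_neq0 ?polyC_eq0 // monic_neq0 ?monicXn.
  rewrite size_Cmul // size_polyXn size_AS_poly dE; lia.
apply: IH.
  apply: leq_trans gm; rewrite dE ltnS.
  apply/leq_sizeP => j; rewrite leq_eqVlt => /orP[/eqP <-|dj].
    have lq : lead_coef (q * AS_poly) = lead_coef g.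
      by rewrite lead_coef_Mmonic ?monic_AS_poly // lead_coefM lead_coefC lead_coefXn mulr1.
    by rewrite coefB -[X in _ - X]/((q * AS_poly)`_d) /d -{2}szq -!lead_coefE lq subrr.
  by rewrite coefB !nth_default ?subr0 // ?szq dE.
apply: wdeg_ltD => //; apply: wdeg_ltN.
have lcn i : (n <= p * i + 3 * d)%N -> (lead_coef g)`_i = 0.
  by move=> h; rewrite lead_coefE -/d gn.
have nd : (3 * d < n)%N.
  rewrite ltnNge; apply: contra lc0 => h; apply/eqP/polyP => i.
  by rewrite lcn ?coef0 //; lia.
have qn : wdeg_lt p (n - 3 * p) q.
  move=> i j h; rewrite coefCM coefXn; case: eqP => [jE|_]; last by rewrite mulr0 coef0.
  by rewrite mulr1 lcn //; lia.
have -> : n = (n - 3 * p + 3 * p)%N by lia.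
by apply: wdeg_ltMr => //; apply: wdeg_AS_poly.
Qed.

End ArtinSchreier.

(** Polynomials that agree in top weight n have powers that agree in top weight: each telescoping
    term contains one factor [g - h]. *)
Lemma wdeg_lt_expB (K : fieldType) p n (g h : {poly {poly K}}) j :
  wdeg_lt p n.+1 g -> wdeg_lt p n.+1 h -> wdeg_lt p n (g - h) ->
  wdeg_lt p (j * n) (g ^+ j - h ^+ j).
Proof.
move=> gn hn ghn; elim: j => [|j IH]; first by rewrite !expr0 subrr; apply: wdeg_lt0.
have -> : g ^+ j.+1 - h ^+ j.+1 = g * (g ^+ j - h ^+ j) + (g - h) * h ^+ j.
  by rewrite !exprS; ring.
rewrite mulSn; apply: wdeg_ltD; first exact: wdeg_ltM.
by apply: wdeg_ltMr => //; apply: wdeg_ltX.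
Qed.

(** Pigeonhole: the difference of two colliding vectors lies in the kernel. Additivity is the right
    generality, because the map used below raises coefficients to the power r and is not
    K-linear. *)
Lemma additive_ker (K : finFieldType) (I J : finType)
    (Phi : {ffun I -> K} -> {ffun J -> K}) :
  (forall u v, Phi (u - v) = Phi u - Phi v) -> (#|J| < #|I|)%N ->
  exists2 u, u != 0 & Phi u = 0.
Proof.
move=> PhiB JI; have /injectivePn[u [v uv Puv]] : ~~ injectiveb Phi.
  apply/negP => /injectiveP /leq_card; rewrite !card_ffun.
  by rewrite leq_exp2l ?finNzRing_gt1 // leqNgt JI.
by exists (u - v); rewrite ?subr_eq0 // PhiB Puv subrr.
Qed.

Lemma frobD (R : comNzRingType) p n : p \in [pchar R] ->
  {morph (fun x : R => x ^+ (p ^ n)) : x y / x + y}.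
Proof.
move=> pR x y; apply: exprDn_pchar; rewrite pnatX (eq_pnat _ (pcharf_eq pR)) pnat_id //.
exact: pcharf_prime pR.
Qed.

Lemma frob_sum (R : comNzRingType) p n (I : Type) (s : seq I) (P : pred I) (G : I -> R) :
  p \in [pchar R] ->
  (\sum_(i <- s | P i) G i) ^+ (p ^ n) = \sum_(i <- s | P i) G i ^+ (p ^ n).
Proof.
move=> pR; apply: (big_morph _ (frobD n pR)); rewrite expr0n expn_eq0.
by rewrite -leqn0 leqNgt prime_gt0 // (pcharf_prime pR).
Qed.

(** * Stepanov's method in Bombieri's form, over a field with r^2 elements *)

Section Stepanov.
Import Pdiv.CommonRing Pdiv.RingMonic.
Variables (K : finFieldType) (p s : nat) (a b c : K).
Hypotheses (pK : p \in [pchar K]) (p3 : (3 < p)%N) (s1 : (1 < s)%N).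
Hypotheses (cardK : #|K| = ((p ^ s) ^ 2)%N) (a0 : a != 0).

Let r := (p ^ s)%N.
Let R := (p ^ s.-1)%N.
Let f := a *: 'X^3 + b *: 'X + c%:P.
Let M := AS_poly p f.
Let T := \sum_(i < s) f ^+ (p ^ i).

Let pr : prime p. Proof. exact: pcharf_prime pK. Qed.
Let rE : r = (p * R)%N. Proof. by rewrite /r /R -expnS prednK // ltnW. Qed.
Let Rp : (p <= R)%N.
Proof. by rewrite /R -{1}(expn1 p) leq_exp2l ?prime_gt1 //; lia. Qed.

Let size_f : size f = 4.
Proof.
rewrite /f -addrA size_polyDl ?size_scale ?size_polyXn //.
apply: leq_ltn_trans (size_polyD _ _) _; rewrite gtn_max.
by rewrite (leq_ltn_trans (size_scale_leq _ _)) ?size_polyX // (leq_ltn_trans (size_polyC_leq1 _)).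
Qed.

Let size_fX n : size (f ^+ n) = (3 * n).+1.
Proof.
have := size_exp f n; rewrite size_f /= => <-; rewrite prednK // size_poly_gt0.
by rewrite expf_neq0 // -size_poly_gt0 size_f.
Qed.

Let size_T : size T = (3 * R).+1.
Proof.
have -> : T = \sum_(i < s.-1) f ^+ (p ^ i) + f ^+ R.
  by rewrite /T /R; move: s1; case: (s) => // s' _; rewrite big_ord_recr.
rewrite addrC size_polyDl size_fX //; rewrite ltnS; apply: leq_trans (size_sum _ _ _) _.
apply/bigmax_leqP => i _; rewrite size_fX.
have : (p ^ i < R)%N by rewrite ltn_exp2l ?prime_gt1.
lia.
Qed.

Let M_monic : M \is monic. Proof. by apply: monic_AS_poly; lia. Qed.

Let wdegM n g : wdeg_lt p n g -> wdeg_lt p n (rmodp g M).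
Proof. by apply: wdeg_lt_rmodp; rewrite ?size_f //; lia. Qed.

Let size_rmodp g : (size (rmodp g M) <= p)%N.
Proof.
have := ltn_rmodpN0 g (monic_neq0 M_monic).
by rewrite {2}/M size_AS_poly ?size_f // (ltn_trans _ p3).
Qed.

Let L := lead_coef T.
Let L0 : L != 0. Proof. by rewrite lead_coef_eq0 -size_poly_gt0 size_T. Qed.
(** On the curve y^r = y + T(x), so [YT] represents y^r. Its part of top weight 3r is the monomial
    [LT], because T has degree 3R. *)
Let YT : {poly {poly K}} := 'X + T%:P.
Let LT : {poly {poly K}} := (L *: 'X^(3 * R))%:P.

Let wdeg_YT : wdeg_lt p (3 * r).+1 YT.
Proof.
apply: wdeg_ltD; first by apply: wdeg_ltW (@wdeg_ltY _ _); lia.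
by apply: wdeg_ltC; rewrite ?size_T; nia.
Qed.

Let wdeg_LT : wdeg_lt p (3 * r).+1 LT.
Proof.
by apply: wdeg_ltC; [apply: leq_trans (leq_mul (leqnn _) (size_scale_leq _ _)) _; rewrite size_polyXn; nia|lia].
Qed.

Let wdeg_YTB : wdeg_lt p (3 * r) (YT - LT).
Proof.
rewrite /YT /LT -addrA -polyCB; apply: wdeg_ltD.
  by apply: wdeg_ltW (@wdeg_ltY _ _); nia.
move=> i j h; rewrite coefC; case: eqP => [jE|_]; last by rewrite coef0.
have {jE}h : (3 * R <= i)%N by move: h; rewrite jE muln0 addn0; nia.
rewrite coefB coefZ coefXn; move: h; rewrite leq_eqVlt => /orP[/eqP <-|h].
  by rewrite eqxx mulr1 /L lead_coefE size_T subrr.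
by rewrite (gtn_eqF h) mulr0 nth_default ?subr0 // size_T.
Qed.

(** For an index u = ((i,j),(k,l)), [R - 2] is the largest bound on i that keeps p i + 3 j below r
    for all j < p; the maximum is then r - 3. With [R + 4] for k, the maximum of p k + 3 l is r + 6p
    - 3, and there are (r - 2p)(r + 4p) unknowns, enough to force H = 0. *)
Let l1 := (R - 2)%N.
Let m1 := (R + 4)%N.
Let I := (('I_l1 * 'I_p) * ('I_m1 * 'I_p))%type.

(* At a rational point y^r = y + T(x) and z^(r^2) = z, so sum d_u^r hE_u is the r-th power of
   sum d_u gE_u there: if the former is 0 modulo AS_poly, the latter vanishes on the curve. *)
Let hE (u : I) : {poly {poly K}} :=
  ('X^(u.1.1 * r + u.2.1))%:P * (YT ^+ u.1.2 * 'X ^+ u.2.2).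
Let gE (u : I) : {poly {poly K}} :=
  ('X^(u.1.1 + u.2.1 * r))%:P * ('X ^+ u.1.2 * YT ^+ u.2.2).
Let deg_u (u : I) := (u.1.1 + u.2.1 * r + u.2.2 * (3 * R))%N.
Let wt (u : I) := (p * deg_u u + 3 * u.1.2)%N.

Let wt_small (u : I) : (p * u.1.1 + 3 * u.1.2 < r)%N.
Proof. case: u => [[[i il] [j jl]] ?] /=; rewrite /l1 in il *; nia. Qed.

Let wtE u : wt u = ((p * u.2.1 + 3 * u.2.2) * r + (p * u.1.1 + 3 * u.1.2))%N.
Proof. rewrite /wt /deg_u rE; ring. Qed.

Let cop3 : coprime p 3.
Proof. by rewrite prime_coprime // gtnNdvd. Qed.

Let wt_pair (x y : nat) (j k : 'I_p) : (p * x + 3 * j = p * y + 3 * k)%N ->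
  x = y /\ j = k.
Proof.
move=> e; have jk : j = k.
  have : (3 * j == 3 * k %[mod p])%N.
    by rewrite -(modnMDl x (3 * j)) -(modnMDl y (3 * k)) ![(_ * p)%N]mulnC e.
  wlog jk : j k x y e / (j <= k)%N.
    move=> W h; case: (leqP j k) => [jk|/ltnW kj]; first exact: (W _ _ _ _ e jk h).
    by apply/esym; apply: (W _ _ _ _ (esym e) kj); rewrite eq_sym.
  rewrite eq_sym eqn_mod_dvd ?leq_mul2l // -mulnBr Gauss_dvdr // => dv.
  apply/val_inj/eqP; rewrite eqn_leq jk leqNgt; apply/negP => kj.
  have := dvdn_leq (_ : 0 < k - j)%N dv; rewrite subn_gt0 => /(_ kj).
  by rewrite leqNgt (leq_ltn_trans (leq_subr _ _)).
by move: e; rewrite jk => /addIn/eqP; rewrite eqn_pmul2l ?prime_gt0 // => /eqP.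
Qed.

(** By [wt_small], [wtE] is a division by r with remainder, so the weight determines p k + 3 l and p
    i + 3 j. Each of these determines its pair, since p is prime to 3 and the multiple of 3 has a
    factor below p. *)
Let wt_inj : injective wt.
Proof.
move=> u v; rewrite !wtE => e.
have r0 : (0 < r)%N by rewrite expn_gt0 prime_gt0.
have e1 : (p * u.2.1 + 3 * u.2.2 = p * v.2.1 + 3 * v.2.2)%N.
  by have := congr1 (divn^~ r) e; rewrite !divnMDl // !(divn_small (wt_small _)) !addn0.
have e2 : (p * u.1.1 + 3 * u.1.2 = p * v.1.1 + 3 * v.1.2)%N.
  by move: e; rewrite e1 => /addnI.
move: u v e1 e2 {e} => [[u11 u12] [u21 u22]] [[v11 v12] [v21 v22]] /=.
by move=> /wt_pair[/val_inj -> ->] /wt_pair[/val_inj -> ->].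
Qed.

(** Replacing [YT] by [LT] only affects lower weights, so [gE u] has a single monomial of weight
    [wt u]. Its y-degree is below p, hence it survives the reduction modulo M. *)
Let lead_gE u : wdeg_lt p (wt u)
   (gE u - (L ^+ u.2.2 *: 'X^(deg_u u))%:P * 'X^(u.1.2)).
Proof.
have -> : (L ^+ u.2.2 *: 'X^(deg_u u))%:P = ('X^(u.1.1 + u.2.1 * r))%:P * LT ^+ u.2.2.
  rewrite /LT -polyC_exp -polyCM exprZn -exprM (mulnC (3 * R)%N) -scalerAr -exprD //.
rewrite /gE mulrA [X in _ - X]mulrAC -mulrBr.
have -> : wt u = (p * (u.1.1 + u.2.1 * r) + u.1.2 * 3 + u.2.2 * (3 * r))%N.
  by rewrite /wt /deg_u rE; ring.
apply: wdeg_ltM; last exact: wdeg_lt_expB.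
apply: wdeg_ltMS; first by apply: wdeg_ltXn; lia.
by apply: wdeg_ltX; apply: wdeg_ltY.
Qed.

Let wdeg_gE u : wdeg_lt p (wt u).+1 (gE u).
Proof.
have -> : wt u = (p * (u.1.1 + u.2.1 * r) + (u.1.2 * 3 + u.2.2 * (3 * r)))%N.
  by rewrite /wt /deg_u rE; ring.
apply: wdeg_ltMS; first by apply: wdeg_ltXn; lia.
by apply: wdeg_ltMS; [apply: wdeg_ltX; apply: wdeg_ltY | apply: wdeg_ltX].
Qed.

Let G (d : {ffun I -> K}) := rmodp (\sum_u (d u)%:P *: gE u) M.
Let H (d : {ffun I -> K}) := rmodp (\sum_u (d u ^+ r)%:P *: hE u) M.

(** Among the indices with [d u != 0], take one of maximal weight. The weights are distinct, so no
    other term can cancel its top monomial. *)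
Let G_neq0 d : d != 0 -> exists2 j, (j < p)%N & (G d)`_j != 0.
Proof.
move=> d0; have [u0 du0] : exists u, d u != 0.
  apply/existsP; apply: contraNT d0; rewrite negb_exists => /forallP d0.
  by apply/eqP/ffunP => u; rewrite ffunE; apply/eqP; rewrite -[_ == _]negbK.
case: (@arg_maxnP _ u0 (fun u => d u != 0) wt du0) => u du maxu {u0 du0}.
exists u.1.2 => //; apply: contraNneq du => /(congr1 (fun q : {poly K} => q`_(deg_u u))).
rewrite /G rmodp_sum // !coef_sum coef0 (bigD1 u) //= [X in _ + X]big1 ?addr0; last first.
  move=> v vu; have [->|dv] := eqVneq (d v) 0; first by rewrite scale0r rmod0p !coef0.
  rewrite rmodpZ // coefZ coefCM (wdegM (@wdeg_gE v)) ?mulr0 //.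
  by have := maxu v dv; rewrite /geq /= leq_eqVlt (inj_eq wt_inj) (negPf vu).
rewrite rmodpZ // coefZ coefCM -[gE u](subrK ((L ^+ u.2.2 *: 'X^(deg_u u))%:P * 'X^(u.1.2))).
rewrite rmodpD // coefD coefD (wdegM (@lead_gE u)) // add0r rmodp_small; last first.
  rewrite /M size_AS_poly ?size_f //; last lia.
  by rewrite mul_polyC (leq_ltn_trans (size_scale_leq _ _)) // size_polyXn ltnS.
by rewrite coefCM coefXn eqxx mulr1 coefZ coefXn eqxx mulr1 => /eqP; rewrite mulf_eq0 expf_eq0 (negPf L0) andbF orbF.
Qed.

Let Lw := ((r - 3) * r + (r + 6 * p - 3))%N.

Let wdeg_H d : wdeg_lt p Lw.+1 (H d).
Proof.
apply: wdegM; apply: wdeg_lt_sum => u _; apply: wdeg_ltZ.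
have : wdeg_lt p (p * (u.1.1 * r + u.2.1) + (u.1.2 * (3 * r) + u.2.2 * 3)).+1 (hE u).
  apply: wdeg_ltMS; first by apply: wdeg_ltXn; lia.
  by apply: wdeg_ltMS; [apply: wdeg_ltX | apply: wdeg_ltX; apply: wdeg_ltY].
apply: wdeg_ltW; rewrite ltnS.
have -> : (p * (u.1.1 * r + u.2.1) + (u.1.2 * (3 * r) + u.2.2 * 3) =
  (p * u.1.1 + 3 * u.1.2) * r + (p * u.2.1 + 3 * u.2.2))%N by ring.
apply: leq_add; last first.
  case: u => [_ [[i il] [j jl]]] /=; rewrite /m1 in il *.
  by move: rE; nia.
rewrite leq_mul2r; apply/orP; right.
by case: u => [[[i il] [j jl]] _] /=; rewrite /l1 in il *; move: rE; nia.
Qed.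

Let wdeg_G d : wdeg_lt p ((r - 3) + (r + 6 * p - 3) * r).+1 (G d).
Proof.
apply: wdegM; apply: wdeg_lt_sum => u _; apply: wdeg_ltZ.
apply: wdeg_ltW (@wdeg_gE u); rewrite ltnS wtE addnC; apply: leq_add.
  by case: u => [[[i il] [j jl]] _] /=; rewrite /l1 in il *; move: rE; nia.
rewrite leq_mul2r; apply/orP; right.
by case: u => [_ [[i il] [j jl]]] /=; rewrite /m1 in il *; move: rE; nia.
Qed.

(** A reduced polynomial of weight at most [Lw] has at most Lw + p coefficients. This is less than
    the number of unknowns because p >= 5 and r >= p^2, the latter from s > 1. *)
Let exists_H0 : exists2 d : {ffun I -> K}, d != 0 & H d = 0.
Proof.
pose J := ('I_(Lw %/ p).+1 * 'I_p)%type.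
pose Phi (d : {ffun I -> K}) : {ffun J -> K} := [ffun ij : J => (H d)`_ij.2`_ij.1].
have HB u v : H (u - v) = H u - H v.
  rewrite /H -rmodpB // -sumrB; congr rmodp; apply: eq_bigr => w _.
  rewrite -scalerBl -polyCB; congr (_%:P *: _).
  by rewrite !ffunE; apply/eqP; rewrite eq_sym subr_eq -frobD // subrK.
have PhiB u v : Phi (u - v) = Phi u - Phi v.
  by apply/ffunP => ij; rewrite !ffunE HB !coefB.
have [|d d0 Phid] := additive_ker PhiB.
  rewrite !card_prod !card_ord.
  have h : ((Lw %/ p).+1 * p <= Lw + p)%N by rewrite mulSn addnC leq_add2r leq_trunc_div.
  apply: leq_ltn_trans h _; rewrite /Lw /l1 /m1.
  have -> : ((R - 2) * p * ((R + 4) * p) = (r - 2 * p) * (r + 4 * p))%N.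
    by rewrite rE mulnBl mulnDl ![(p * R)%N]mulnC; ring.
  have : (p * p <= r)%N by rewrite rE leq_mul2l Rp orbT.
  have : (5 <= p)%N.
    by move: (p) p3 pr => [|[|[|[|[|q]]]]].
  move=> p5 ppr; have p5' : (5 * p <= p * p)%N by rewrite leq_mul2r p5 orbT.
  have [t rt] : exists t, r = (2 * p + t)%N by exists (r - 2 * p)%N; lia.
  have : (p * (3 * p) <= p * t)%N by rewrite leq_mul2l; apply/orP; right; lia.
  have -> : ((r - 3) * r = r * r - 3 * r)%N by rewrite mulnBl.
  rewrite rt addKn !(mulnDl, mulnDr).
  have : (4 * t <= p * t)%N by rewrite leq_mul2r ltnW ?orbT.
  move: (p) (t) p5 p5' => P t'; clear.
  lia.
exists d => //; apply/polyP => j; apply/polyP => i; rewrite !coef0.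
have [pj|jp] := leqP p j.
  by rewrite (nth_default _ (leq_trans (size_rmodp _) pj)) coef0.
have [iL|Li] := ltnP i (Lw %/ p).+1.
  by move/ffunP: Phid => /(_ (Ordinal iL, Ordinal jp)); rewrite !ffunE.
by apply: wdeg_H; move: Li; rewrite ltn_divLR ?prime_gt0 //; lia.
Qed.

Definition AS_image : {set K} := [set x | [exists y : K, y ^+ p - y == x]].

Let horner_mod x y g : y ^+ p - y = f.[x] ->
  (rmodp g M).[y%:P].[x] = g.[y%:P].[x].
Proof.
move=> yx; rewrite [in RHS](rdivp_eq M_monic g) hornerD hornerM hornerD hornerM.
suff -> : M.[y%:P].[x] = 0 by rewrite mulr0 add0r.
rewrite /M /AS_poly; move: (f) yx => f' yx.
by rewrite !hornerE -yx; ring.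
Qed.

Let horner_pow n x y : y ^+ p - y = f.[x] ->
  y ^+ (p ^ n) = y + \sum_(i < n) f.[x] ^+ (p ^ i).
Proof.
move=> yx; elim: n => [|n IH]; first by rewrite big_ord0 addr0.
rewrite big_ord_recr addrA -IH -frobD // expnS exprM -yx; congr (_ ^+ _); ring.
Qed.

(** Over each x in Z lie the p points y0 + n with n in the prime field. G vanishes at all of them
    and has y-degree below p, so every y-coefficient of G vanishes at x. A nonzero coefficient then
    has all of Z among its roots, and p times its degree is bounded by the weight of G. *)
Lemma Stepanov_bound :
  (p * #|[set x | f.[x] \in AS_image]| <= r ^ 2 + 6 * p * r)%N.
Proof.
set Z := [set x | _].
have [d d0 Hd] := exists_H0; have [j jp Gj] := G_neq0 d0.
have rootG x : x \in Z -> root (G d)`_j x.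
  rewrite !inE => /existsP[y0 /eqP y0x].
  have Gxy y : y ^+ p - y = f.[x] -> (G d).[y%:P].[x] = 0.
    move=> yx; have yr : y ^+ r = y + T.[x].
      rewrite (horner_pow s yx) /T horner_sum; congr (_ + _).
      by apply: eq_bigr => i _; rewrite horner_exp.
    have powrr (z : K) : (z ^+ r) ^+ r = z.
      by rewrite -exprM mulnn -cardK expf_card.
    have : (G d).[y%:P].[x] ^+ r = (H d).[y%:P].[x].
      rewrite !horner_mod // !horner_sum frob_sum //; apply: eq_bigr => u _.
      rewrite !hornerE /= -yr !exprMn -!exprM.
      rewrite -/r; congr (_ * _ * _ * _).
      - by rewrite mulnDl !exprD [x ^+ (_ * _ * r)]exprM [x ^+ (_ * r)]exprM powrr.
      - by rewrite mulnC.
      - by rewrite mulnCA mulnA !exprM powrr.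
    by rewrite Hd !horner0 => /eqP; rewrite expf_eq0 => /andP[_ /eqP].
  pose gx := map_poly (horner_eval x) (G d).
  have gxE y : gx.[y] = (G d).[y%:P].[x].
    by rewrite -[RHS]/(horner_eval x _) -horner_map /= /horner_eval hornerC.
  suff : gx = 0 by move=> /(congr1 (fun q : {poly K} => q`_j)); rewrite coef_map coef0 => /= h; apply/eqP.
  apply: (@roots_geq_poly_eq0 _ _ [seq y0 + n%:R | n <- iota 0 p]).
  - apply/allP => _ /mapP[n _ ->]; apply/eqP; rewrite gxE Gxy //.
    rewrite -{1}[p]expn1 frobD // expn1 -[n%:R ^+ p]/(pFrobenius_aut pK n%:R) pFrobenius_aut_nat -y0x; ring.
  - rewrite map_inj_in_uniq ?iota_uniq // => m n; rewrite !mem_iota !add0n /= => mp np /addrI.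
    wlog mn : m n mp np / (m <= n)%N.
      by move=> W; case: (leqP m n) => [|/ltnW] h e; [|symmetry]; apply: W.
    move=> /esym/eqP; rewrite -subr_eq0 -natrB // -(dvdn_pcharf pK) => dv.
    apply/eqP; rewrite eqn_leq mn leqNgt; apply/negP => h.
    have := dvdn_leq (_ : 0 < n - m)%N dv; rewrite subn_gt0 => /(_ h).
    by rewrite leqNgt (leq_ltn_trans (leq_subr _ _)).
  - rewrite size_map size_iota; apply: leq_trans (size_poly _ _) _.
    exact: size_rmodp.
have Zs : (#|Z| < size ((G d)`_j)%R)%N.
  rewrite cardE; apply: max_poly_roots; rewrite ?enum_uniq //.
  by apply/allP => x; rewrite mem_enum; apply: rootG.
have wtj : (p * (size ((G d)`_j)%R).-1 + 3 * j <= (r - 3) + (r + 6 * p - 3) * r)%N.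
  rewrite leqNgt; apply: contra Gj => h.
  by rewrite -lead_coef_eq0 lead_coefE (@wdeg_G d _ _ h).
have : (p * #|Z| <= p * (size ((G d)`_j)%R).-1)%N.
  by rewrite leq_mul2l -ltnS prednK ?Zs ?orbT //; apply: leq_ltn_trans Zs.
have : (r <= r * r)%N by rewrite -{1}[r]muln1 leq_mul2l expn_gt0 prime_gt0 ?orbT.
move: wtj; rewrite -mulnn mulnBl mulnDl.
move: (p * #|Z|)%N (p * _.-1)%N (6 * p * r)%N (r * r)%N (r) => *; lia.
Qed.
End Stepanov.

(** * Quadratic extensions and sums over squares *)

Section QuadraticExtension.
Variable F : finFieldType.
Hypothesis F2 : (2 : F) != 0.

Lemma exists_nonsquare : exists d : F, forall x, x ^+ 2 != d.
Proof.
have : ~~ injectiveb (fun x : F => x ^+ 2).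
  apply/negP => /injectiveP /(_ 1 (-1)); rewrite sqrrN expr1n => /(_ erefl).
  by move/eqP; rewrite -subr_eq0 opprK -mulr2n (negPf F2).
move=> ninj; pose S := (fun x : F => x ^+ 2) @: setT.
have [d dS] : exists d, d \notin S.
  apply/existsP; apply: contraR ninj; rewrite negb_exists => /forallP allS.
  apply/injectiveP => x y; have /imset_injP inj : #|S| == #|[set: F]|.
    by apply/eqP/eq_card => d; rewrite inE; apply/negbNE.
  by apply: inj; rewrite inE.
by exists d => x; apply: contra dS => /eqP <-; apply/imsetP; exists x; rewrite ?inE.
Qed.

Lemma quadratic_extension (d : F) : (forall x, x ^+ 2 != d) ->
  exists (F' : finFieldType) (iota : {rmorphism F -> F'}) (t : F'),
    t ^+ 2 = iota d /\ #|F'| = (#|F| ^ 2)%N.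
Proof.
move=> dn; pose h := 'X^2 - d%:P.
have sh : size h = 3 by rewrite size_XnsubC.
have mi : monic_irreducible_poly h.
  split; last exact: monicXnsubC.
  apply: cubic_irreducible; rewrite ?sh // => x.
  by rewrite /root !hornerE subr_eq0 dn.
pose F' : finFieldType := {poly %/ h with mi}.
exists F', (in_qpoly h \o polyC), (in_qpoly h 'X : F'); split; last first.
  by rewrite card_qfpoly sh.
apply/eqP; rewrite -subr_eq0 -rmorphXn -rmorphB /=; apply/eqP/val_inj.
by rewrite /= mk_monicE // Pdiv.RingMonic.rmodpp // monicXnsubC.
Qed.

Lemma quadratic_coord_bij (F' : finFieldType) (iota : {rmorphism F -> F'}) (t : F') (d : F) :
  (forall x, x ^+ 2 != d) -> t ^+ 2 = iota d -> #|F'| = (#|F| ^ 2)%N ->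
  bijective (fun u : F * F => iota u.1 + iota u.2 * t).
Proof.
move=> dn td cF; apply: inj_card_bij; last by rewrite cF card_prod mulnn.
move=> [x y] [z w] /= e.
have e2 : iota (x - z) = iota (w - y) * t.
  by rewrite !rmorphB mulrBl; apply/eqP; rewrite subr_eq addrAC eq_sym subr_eq e addrC.
have [wy|wy] := eqVneq w y.
  by move: e2; rewrite wy subrr rmorph0 mul0r => /eqP; rewrite fmorph_eq0 subr_eq0 => /eqP ->.
have := dn ((x - z) / (w - y)); rewrite -(inj_eq (fmorph_inj iota)) -td.
rewrite rmorphXn rmorphM fmorphV e2 mulrAC divff ?mul1r ?eqxx //.
by rewrite fmorph_eq0 subr_eq0.
Qed.

(** Every t has exactly two preimages in total under v^2 and d v^2: at most two because d is a
    nonsquare, and the total count 2|F| leaves no room for fewer. *)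
Lemma sum_squares (d : F) (h : F -> algC) : (forall x, x ^+ 2 != d) ->
  \sum_v h (v ^+ 2) + \sum_v h (d * v ^+ 2) = 2 * \sum_t h t.
Proof.
move=> dn; pose n t := (#|[set v : F | v ^+ 2 == t]| + #|[set v : F | (d * v ^+ 2)%R == t]|)%N.
have d0 : d != 0 by have := dn 0; rewrite expr0n eq_sym.
have sqpm (u v : F) : u ^+ 2 = v ^+ 2 -> u \in [set v; - v].
  by move=> /eqP; rewrite eqf_sqr !inE.
have n2 t : (n t <= 2)%N.
  rewrite /n; have [->|t0] := eqVneq t 0.
    have c1 (S : {set F}) : S \subset [set 0] -> (#|S| <= 1)%N.
      by move/subset_leq_card; rewrite cards1.
    apply: (@leq_add _ _ 1 1); apply: c1; apply/subsetP => v; rewrite !inE.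
      by rewrite expf_eq0.
    by rewrite mulf_eq0 (negPf d0) expf_eq0.
  have pm2 (S : {set F}) w : S \subset [set w; - w] -> (#|S| <= 2)%N.
    by move/subset_leq_card/leq_trans; apply; rewrite cards2; case: (_ != _).
  have [v vt|nv] := pickP [pred v : F | v ^+ 2 == t].
    rewrite (_ : [set v | d * v ^+ 2 == t] = set0) ?cards0 ?addn0.
      apply: (pm2 _ v); apply/subsetP => u; rewrite inE => /eqP ut.
      by apply: sqpm; rewrite ut (eqP vt).
    apply/setP => u; rewrite !inE; apply/negP => /eqP ut.
    have u0 : u != 0 by apply: contra t0 => /eqP u0; rewrite -ut u0 expr0n mulr0.
    by case/eqP: (dn (v / u)); rewrite expr_div_n (eqP vt) -ut mulfK // expf_neq0.
  rewrite (_ : [set v | v ^+ 2 == t] = set0) ?cards0 ?add0n; last first.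
    by apply/setP => u; rewrite !inE; exact: nv.
  have [->|[v]] := set_0Vmem [set v | d * v ^+ 2 == t]; first by rewrite cards0.
  rewrite inE => /eqP vt; apply: (pm2 _ v); apply/subsetP => u; rewrite inE => /eqP ut.
  by apply: sqpm; apply: (mulfI d0); rewrite ut.
have fib (g : F -> F) (k : F -> algC) : \sum_v k (g v) = \sum_t #|[set v | g v == t]|%:R * k t.
  rewrite (partition_big g predT) //=; apply: eq_bigr => t _.
  rewrite (eq_bigr (fun _ => k t)) => [|v /eqP -> //].
  by rewrite sumr_const mulr_natl cardsE.
have fibn (g : F -> F) : (\sum_t #|[set v | g v == t]| = #|F|)%N.
  rewrite -[RHS]sum1_card [RHS](partition_big g predT) //=; apply: eq_bigr => t _.
  by rewrite sum1dep_card.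
have sn : (\sum_t n t = \sum_(t : F) 2)%N.
  by rewrite big_split /= !fibn sum_nat_const muln2 addnn.
have /leqif_sum : forall t : F, predT t -> (n t <= 2 ?= iff (n t == 2))%N by move=> t _; split.
move=> [_]; rewrite sn eqxx => /esym /forall_inP nE.
rewrite (fib (fun v => v ^+ 2)) (fib (fun v => d * v ^+ 2)) -big_split mulr_sumr /=.
by apply: eq_bigr => t _; rewrite -mulrDl -natrD -/(n t) (eqP (nE t isT)).
Qed.

End QuadraticExtension.

(* These are exactly the characters zeta_p^Tr(c x) with c in F_p^*; described this way,
   composition with the trace of a quadratic extension preserves them. *)
Definition trace_char (F : finFieldType) (p : nat) (psi : F -> algC) :=
  [/\ psi 0 = 1, {morph psi : x y / x + y >-> x * y},
      forall x, psi (x ^+ p) = psi x & exists x, psi x != 1].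

Definition cubic_sum (F : finFieldType) (psi : F -> algC) (a b : F) : algC :=
  \sum_x psi (a * x ^+ 3 + b * x).

(** * Additive characters and cubic sums *)

Section TraceChar.
Variables (F : finFieldType) (p : nat) (psi : F -> algC).
Hypotheses (pF : p \in [pchar F]) (psiP : trace_char p psi).

Let pr : prime p. Proof. exact: pcharf_prime pF. Qed.
Let psi0 : psi 0 = 1. Proof. by case: psiP. Qed.
Let psiD : {morph psi : x y / x + y >-> x * y}. Proof. by case: psiP. Qed.
Let psi_frob x : psi (x ^+ p) = psi x. Proof. by case: psiP. Qed.

Lemma char_sum0 : \sum_x psi x = 0.
Proof.
have [_ _ _ [x0 x01]] := psiP; apply/eqP.
have : psi x0 * \sum_x psi x = \sum_x psi x.
  rewrite mulr_sumr [RHS](reindex (fun x => x0 + x)); last first.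
    by exists (fun x => x - x0) => x _; [rewrite addrC addKr | rewrite addrC subrK].
  by apply: eq_bigr => x _; rewrite psiD.
move/eqP; rewrite -subr_eq0 -{2}[\sum_x _]mul1r -mulrBl mulf_eq0 subr_eq0.
by rewrite (negPf x01).
Qed.

Lemma char_sumM c : \sum_x psi (c * x) = #|F|%:R * (c == 0)%:R.
Proof.
have [->|c0] := eqVneq c 0.
  under eq_bigr do rewrite mul0r psi0.
  by rewrite sumr_const mulr1.
rewrite mulr0 -[RHS]char_sum0 [RHS](reindex (fun x => c * x)) //.
by exists (fun x => c^-1 * x) => x _; rewrite mulrA (mulVf, mulfV) ?mul1r.
Qed.

Lemma char_mulrn x n : psi (x *+ n) = psi x ^+ n.
Proof. by elim: n => [|n IH]; rewrite ?psi0 // mulrS exprS psiD IH. Qed.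

Lemma char_expp x : psi x ^+ p = 1.
Proof. by rewrite -char_mulrn (mulrn_pchar pF) psi0. Qed.

Lemma char_norm x : `|psi x| = 1.
Proof.
apply/eqP; rewrite -(@pexpr_eq1 _ _ p) ?prime_gt0 //.
by rewrite -normrX char_expp normr1.
Qed.

Lemma char_mulN x : psi x * psi (- x) = 1.
Proof. by rewrite -psiD subrr psi0. Qed.

Lemma char_conj x : (psi x)^* = psi (- x).
Proof.
have nz : psi x != 0 by rewrite -normr_eq0 char_norm oner_eq0.
by apply: (mulfI nz); rewrite char_mulN -normCK char_norm expr1n.
Qed.

(** The polynomial a x^3 + b x is odd, so substituting -x conjugates the sum. *)
Lemma cubic_sum_real a b : cubic_sum psi a b \is Num.real.
Proof.
apply/CrealP; rewrite /cubic_sum rmorph_sum /= (reindex_inj oppr_inj) /=.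
by apply: eq_bigr => x _; rewrite char_conj; congr psi; ring.
Qed.

Lemma char_AS_image y : y \in AS_image F p -> psi y = 1.
Proof.
by rewrite inE => /existsP[x /eqP <-]; rewrite psiD psi_frob char_mulN.
Qed.

Lemma card_AS_image : (#|F| <= p * #|AS_image F p|)%N.
Proof.
pose g (y : F) := y ^+ p - y.
rewrite -[X in (X <= _)%N]sum1_card (partition_big g (fun z => z \in AS_image F p)) /=; last first.
  by move=> y _; rewrite inE; apply/existsP; exists y.
have -> : (p * #|AS_image F p| = \sum_(z in AS_image F p) p)%N.
  by rewrite sum_nat_const mulnC.
apply: leq_sum => z _; rewrite sum1dep_card cardE.
pose q : {poly F} := 'X^p - ('X + z%:P).
have szq : size q = p.+1.
  by rewrite /q size_polyDl size_polyXn // size_polyN size_XaddC ltnS prime_gt1.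
rewrite -ltnS -szq; apply: max_poly_roots; rewrite ?enum_uniq //.
  by rewrite -size_poly_gt0 szq.
apply/allP => y; rewrite mem_enum inE /root /q !hornerE => /eqP <-.
by rewrite /g; apply/eqP; ring.
Qed.

(** An upper bound for all the twists f - c suffices, since the average of the counts N c is known
    exactly: the nonnegative defects B - p N c have a controlled total, and the cubic sum is, up to
    sign and scaling, their Fourier coefficient at psi. *)
Lemma cubic_sum_bound (a b : F) s : (3 < p)%N -> (1 < s)%N ->
  #|F| = ((p ^ s) ^ 2)%N -> a != 0 ->
  `|cubic_sum psi a b| <= (6 * p * p ^ s)%:R.
Proof.
move=> p3 s1 cF a0; set r := (p ^ s)%N; set im := AS_image F p.
pose f x := a * x ^+ 3 + b * x.
pose N c := #|[set x | f x - c \in im]|.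
have Nle c : (p * N c <= r ^ 2 + 6 * p * r)%N.
  have := Stepanov_bound b (- c) pF p3 s1 cF a0; rewrite (_ : #|_| = N c) //.
  by apply: eq_card => x; rewrite [LHS]inE [RHS]inE !(hornerD, hornerZ, hornerXn, hornerX, hornerC).
have sumN (h : F -> algC) : (forall x y, y \in im -> h (x - y) = h x) ->
    \sum_c h c * (N c)%:R = #|im|%:R * \sum_x h (f x).
  move=> him.
  transitivity (\sum_c \sum_(x | f x - c \in im) h c).
    apply: eq_bigr => c _; rewrite sumr_const mulr_natr; congr (_ *+ _).
    by apply: eq_card => x; rewrite [LHS]inE.
  rewrite (exchange_big_dep predT) //= mulr_sumr; apply: eq_bigr => x _.
  rewrite (reindex_inj (subrI (f x))) /=.
  rewrite (eq_big (fun y => y \in im) (fun=> h (f x))).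
  - by rewrite sumr_const mulr_natl.
  - by move=> y; rewrite opprB addrC subrK.
  - by move=> y; rewrite opprB addrC subrK => /him.
have sumN1 : \sum_c (N c)%:R = #|im|%:R * #|F|%:R :> algC.
  by have := sumN (fun=> 1) (fun _ _ _ => erefl); rewrite sumr_const => <-; apply: eq_bigr => c _; rewrite mul1r.
have sumNpsi : \sum_c psi c * (N c)%:R = #|im|%:R * cubic_sum psi a b.
  apply: sumN => x y /char_AS_image yim.
  by rewrite psiD -[psi (- y)]mul1r -{1}yim char_mulN mulr1.
set B := (r ^ 2 + 6 * p * r)%N.
(* The constant B may be inserted freely because psi sums to zero; the triangle inequality is then
   applied to nonnegative weights. *)
have key : (p * #|im|)%:R * `|cubic_sum psi a b| <= #|F|%:R * B%:R - (p * #|im|)%:R * #|F|%:R.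
  have -> : (p * #|im|)%:R * `|cubic_sum psi a b| = `|\sum_c psi c * (B%:R - (p * N c)%:R)|.
    rewrite -(ger0_norm (ler0n _ (p * #|im|))) -normrM -[RHS]normrN; congr `|_|.
    rewrite natrM -mulrA -sumNpsi mulr_sumr -sumrN.
    under [RHS]eq_bigr do rewrite mulrBr opprB natrM.
    rewrite sumrB -mulr_suml char_sum0 mul0r subr0.
    by apply: eq_bigr => c _; rewrite mulrCA.
  apply: le_trans (ler_norm_sum _ _ _) _.
  under eq_bigr => c _ do rewrite normrM char_norm mul1r ger0_norm ?subr_ge0 ?ler_nat ?Nle //.
  rewrite sumrB sumr_const natrM -mulrA -sumN1 mulr_sumr mulr_natl.
  by rewrite lerD2l lerN2; apply: ler_sum => c _; rewrite natrM.
have imF := card_AS_image; rewrite -/im in imF.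
have F0 : (0 < #|F|)%N by apply/card_gt0P; exists 0.
have im0 : 0 < (p * #|im|)%:R :> algC by rewrite ltr0n (leq_trans F0).
rewrite -(ler_pM2l im0); apply: le_trans key _.
rewrite -!natrM lerBlDr -natrD ler_nat.
have -> : B = (#|F| + 6 * p * r)%N by rewrite cF.
by rewrite -mulnDr addnC leq_mul.
Qed.

End TraceChar.

(** With z = s + w t and t^2 = d, the new sum and the square of the old one are both double sums of
    g(s) psi(6 a s u), where u = d w^2 and u = w^2 respectively. By [sum_squares] they add up to
    twice the sum over all s and u, where only s = 0 survives. This is the Hasse-Davenport relation
    in degree 2. *)
Lemma quadratic_step (F : finFieldType) p psi (a b : F) :
  p \in [pchar F] -> (3 < p)%N -> trace_char p psi -> a != 0 ->
  exists (F' : finFieldType) (psi' : F' -> algC) (a' b' : F'),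
  [/\ p \in [pchar F'], #|F'| = (#|F| ^ 2)%N, trace_char p psi', a' != 0 &
   cubic_sum psi' a' b' = 2 * #|F|%:R - cubic_sum psi a b ^+ 2].
Proof.
move=> pF p3 psiP a0; have pr := pcharf_prime pF.
have natF n : (0 < n < p)%N -> (n%:R : F) != 0.
  by move=> /andP[n0 np]; rewrite -(dvdn_pcharf pF) gtnNdvd.
have F2 : (2 : F) != 0 by apply: natF; lia.
have F3 : (3 : F) != 0 by apply: natF.
have [d dn] := exists_nonsquare F2.
have [F' [iota [t [td cF']]]] := quadratic_extension dn.
have [co coK Kco] := quadratic_coord_bij dn td cF'.
have [psi0 psiD psi_frob [x0 x01]] := psiP.
have coE s w : co (iota s + iota w * t) = (s, w) by exact: (coK (s, w)).
have zE z : z = iota (co z).1 + iota (co z).2 * t by rewrite Kco.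
(* The conjugate of t is -t, so twice the first coordinate is the trace of z. *)
pose psi' z := psi (2 * (co z).1).
have psi'E s w : psi' (iota s + iota w * t) = psi (2 * s) by rewrite /psi' coE.
have pF' : p \in [pchar F'] by rewrite (fmorph_pchar iota).
have twop : (2 : F) ^+ p = 2 by rewrite -[LHS]/(pFrobenius_aut pF 2) pFrobenius_aut_nat.
have psi'P : trace_char p psi'.
  split.
  - by rewrite -[0]addr0 -{1}(rmorph0 iota) -{1}(mul0r t) -(rmorph0 iota) psi'E mulr0.
  - move=> x y; rewrite (zE x) (zE y) addrACA -mulrDl -!rmorphD !psi'E.
    by rewrite mulrDr psiD.
  - move=> x; rewrite (zE x) -[p in _ ^+ p]expn1 (frobD 1 pF') expn1 exprMn.
    have -> : t ^+ p = iota (d ^+ p./2) * t.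
      rewrite rmorphXn -td -exprM -exprSr mul2n -add1n.
      have po : odd p by case: (even_prime pr) => // p2; move: p3; rewrite p2.
      by rewrite -{1}(odd_double_half p) po.
    by rewrite mulrA -!(rmorphXn iota) -(rmorphM iota) !psi'E -[RHS]psi_frob exprMn twop.
  - exists (iota (x0 / 2) + iota 0 * t); rewrite psi'E mulrC divfK //.
exists F', psi', (iota a), (iota b); split=> //; first by rewrite fmorph_eq0.
pose g (s : F) := psi (2 * a * s ^+ 3 + 2 * b * s).
have S1 : cubic_sum psi' (iota a) (iota b) =
    \sum_s \sum_w g s * psi (6 * a * s * (d * w ^+ 2)).
  rewrite /cubic_sum (reindex (fun u : F * F => iota u.1 + iota u.2 * t)); last first.
    by exists co => z _.
  rewrite pair_big /=; apply: eq_bigr => -[s w] _ /=.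
  have -> : iota a * (iota s + iota w * t) ^+ 3 + iota b * (iota s + iota w * t) =
      iota (a * (s ^+ 3 + 3 * s * (d * w ^+ 2)) + b * s) +
      iota (a * (3 * s ^+ 2 * w + w ^+ 3 * d) + b * w) * t.
    by rewrite !(rmorphD, rmorphM, rmorphXn) -td; ring.
  by rewrite psi'E /g -psiD; congr psi; ring.
have S2 : cubic_sum psi a b ^+ 2 =
    \sum_s \sum_w g s * psi (6 * a * s * w ^+ 2).
  rewrite expr2 /cubic_sum big_distrlr !pair_big /=.
  (* The two variables of the squared sum become s + w and s - w. *)
  rewrite (reindex_inj (_ : injective (fun u : F * F => (u.1 + u.2, u.1 - u.2)))) /=.
    by apply: eq_bigr => -[s w] _ /=; rewrite /g -!psiD; congr psi; ring.
  move=> [s w] [s' w'] /= [e1 e2].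
  have ss : s = s'.
    apply: (mulfI F2); rewrite -[LHS]/(2 * s).
    have -> : 2 * s = (s + w) + (s - w) by ring.
    by rewrite e1 e2; ring.
  by move: e1; rewrite ss => /addrI ->.
apply/eqP; rewrite -subr_eq opprK S1 S2 -big_split /=.
under eq_bigr => s _ do
  rewrite -!mulr_sumr -mulrDr addrC (sum_squares (fun u => psi (6 * a * s * u)) dn) (char_sumM psiP).
rewrite (bigD1 0) //= big1 ?addr0 => [|s s0].
  by rewrite /g expr0n /= !mulr0 addr0 psi0 eqxx mul1r mulr1.
have -> : (6 * a * s == 0) = false.
  by rewrite (_ : (6 : F) = 2 * 3) ?mulf_eq0 ?(negPf F2, negPf F3, negPf a0, negPf s0) // -natrM.
by rewrite !mulr0.
Qed.

(** * The Weil bound for cubic sums *)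

Section Weil.
Variable p : nat.
Hypothesis p3 : (3 < p)%N.

Let excess (F : finFieldType) psi (a b : F) : algC := cubic_sum psi a b ^+ 2 - 4 * #|F|%:R.

Let excess_real (F : finFieldType) psi (a b : F) :
  p \in [pchar F] -> trace_char p psi -> excess psi a b \is Num.real.
Proof.
by move=> pF psiP; rewrite rpredB ?rpredX ?(cubic_sum_real pF psiP) // rpredM ?realn.
Qed.

Lemma excess_step (F : finFieldType) psi (a b : F) :
  p \in [pchar F] -> trace_char p psi -> a != 0 ->
  exists (F' : finFieldType) (psi' : F' -> algC) (a' b' : F'),
  [/\ p \in [pchar F'], #|F'| = (#|F| ^ 2)%N, trace_char p psi', a' != 0 &
   excess psi' a' b' = (excess psi a b + 4 * #|F|%:R) * excess psi a b].
Proof.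
move=> pF psiP a0; have [F' [psi' [a' [b' [pF' cF' psi'P a'0 S']]]]] := quadratic_step b pF p3 psiP a0.
exists F', psi', a', b'; split=> //; rewrite /excess S' cF' natrX; ring.
Qed.

(** Induction over all fields at once. For D > 0 the excess over the quadratic extension is at least
    4qD; the hypothesis there, divided by q, gains one factor 4 while the constant 36 p^2 stays
    fixed. *)
Lemma excess_le n (F : finFieldType) psi (a b : F) s :
  p \in [pchar F] -> trace_char p psi -> a != 0 ->
  (1 < s)%N -> #|F| = ((p ^ s) ^ 2)%N ->
  4 ^+ n * excess psi a b <= (36 * p ^ 2 * #|F|)%:R.
Proof.
elim: n F psi a b s => [|n IH] F psi a b s pF psiP a0 s1 cF.
  rewrite mul1r lerBlDr -[leLHS]ger0_norm ?sqr_ge0; last first.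
    by rewrite real_exprn_even_ge0 // (cubic_sum_real pF psiP).
  rewrite normrX; apply: (@le_trans _ _ ((6 * p * p ^ s) ^ 2)%N%:R).
    rewrite natrX; have B := cubic_sum_bound pF psiP b p3 s1 cF a0.
    by apply: lerXn2r B; rewrite nnegrE ?ler0n ?normr_ge0.
  by rewrite -[4]/(4%:R) -natrM -natrD ler_nat cF !expnMn leq_addr.
have [F' [psi' [a' [b' [pF' cF' psi'P a'0 D']]]]] := excess_step b pF psiP a0.
set D := excess psi a b in D' *.
have Dr : D \is Num.real by apply: excess_real.
have q0 : 0 < #|F|%:R :> algC by rewrite ltr0n; apply/card_gt0P; exists 0.
have [D0|D0] := real_leP Dr (real0 algC).
  by apply: (@le_trans _ _ 0); rewrite ?ler0n // mulr_ge0_le0 // exprn_ge0.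
have /IH : (1 < 2 * s)%N by lia.
have cF2 : #|F'| = ((p ^ (2 * s)) ^ 2)%N by rewrite cF' cF -!expnM; congr expn; lia.
move=> /(_ F' psi' a' b' pF' psi'P a'0 cF2); rewrite D' cF' => h.
rewrite -(ler_pM2l q0); apply: le_trans (_ : _ <= (36 * p ^ 2 * #|F| ^ 2)%:R) _; last first.
  by rewrite -natrM ler_nat; lia.
apply: le_trans h; rewrite exprSr -mulrA mulrCA ler_pM2l ?exprn_gt0 //.
by rewrite mulrA ler_pM2r // mulrC lerDr ltW.
Qed.

(** In [large], an n beyond C / D refutes D > 0. Two quadratic extensions bring an arbitrary field
    to size (p^(2e))^2 with 2e > 1, and nonpositivity descends because D > 0 would make (D + 4q) D
    positive. *)
Lemma excess_le0 (F : finFieldType) psi (a b : F) e :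
  p \in [pchar F] -> trace_char p psi -> a != 0 ->
  #|F| = (p ^ e)%N -> excess psi a b <= 0.
Proof.
have large (K : finFieldType) psi' (a' b' : K) s : p \in [pchar K] -> trace_char p psi' ->
    a' != 0 -> (1 < s)%N -> #|K| = ((p ^ s) ^ 2)%N -> excess psi' a' b' <= 0.
  move=> pK psiP a0 s1 cK; set D := excess _ _ _.
  have Dr : D \is Num.real by apply: excess_real.
  rewrite real_leNgt ?real0 //; apply/negP => D0.
  set C : algC := (36 * p ^ 2 * #|K|)%:R.
  have CDr : C / D \is Num.real by rewrite rpred_div ?realn.
  have := real_truncnS_gt CDr; set n := (Num.truncn _).+1.
  rewrite ltr_pdivrMr // => h.
  have : C < 4 ^+ n * D.
    by apply: lt_le_trans h _; rewrite ler_pM2r // -[4]/(4%:R) -natrX ler_nat ltnW // ltn_expl.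
  by move/lt_geF; rewrite (@excess_le n _ _ _ _ s).
have step (K : finFieldType) psi' (a' b' : K) : p \in [pchar K] -> trace_char p psi' ->
    (excess psi' a' b' + 4 * #|K|%:R) * excess psi' a' b' <= 0 -> excess psi' a' b' <= 0.
  move=> pK psiP; set D := excess _ _ _ => h.
  have Dr : D \is Num.real by apply: excess_real.
  rewrite real_leNgt ?real0 //; apply/negP => D0.
  suff /lt_geF : 0 < (D + 4 * #|K|%:R) * D by rewrite h.
  by rewrite mulr_gt0 // ltr_wpDr // mulr_ge0 ?ler0n.
move=> pF psiP a0 cF; have pr := pcharf_prime pF.
have e0 : (0 < e)%N.
  by case: e cF => // cF; have := finNzRing_gt1 F; rewrite cF.
have [F1 [psi1 [a1 [b1 [pF1 cF1 psi1P a10 D1]]]]] := excess_step b pF psiP a0.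
have [F2 [psi2 [a2 [b2 [pF2 cF2 psi2P a20 D2]]]]] := excess_step b1 pF1 psi1P a10.
apply: (step) => //; rewrite -D1; apply: (step) => //; rewrite -D2.
apply: (large _ _ _ _ (2 * e)%N) => //; first lia.
by rewrite cF2 cF1 cF -!expnM; congr expn; lia.
Qed.

Theorem cubic_sum_weil (F : finFieldType) psi (a b : F) e :
  p \in [pchar F] -> trace_char p psi -> a != 0 -> #|F| = (p ^ e)%N ->
  cubic_sum psi a b <= 2 * sqrtC #|F|%:R.
Proof.
move=> pF psiP a0 cF.
have Sr := cubic_sum_real pF psiP a b.
have R0 : 0 <= 2 * sqrtC #|F|%:R :> algC by rewrite mulr_ge0 ?sqrtC_ge0 ?ler0n.
apply: le_trans (real_ler_norm Sr) _.
rewrite -(@ler_pXn2r _ 2) ?nnegrE //.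
rewrite -normrX ger0_norm ?real_exprn_even_ge0 // exprMn sqrtCK.
have := excess_le0 b pF psiP a0 cF; by rewrite subr_le0 -natrX.
Qed.
End Weil.

(** * The root of unity [zeta p] has order p *)

Section Zeta.
Variable p : nat.
Hypotheses (pr : prime p) (podd : odd p).

Let p0 : (0 < p)%N. Proof. exact: prime_gt0. Qed.
Let rho : algC := p.-root (-1).
Let rho_p : rho ^+ p = -1. Proof. by rewrite rootCK. Qed.

Lemma zeta_expp : zeta p ^+ p = 1.
Proof. by rewrite /zeta -/rho exprAC rho_p sqrrN expr1n. Qed.

(** The delicate case is rho = -1. The principal root has the largest real part among the roots of
    y^p = -1 in the closed upper half-plane, so all of these would equal -1. For a p-th root of
    unity w other than 1, however, -w or its conjugate is another one. *)
Lemma zeta_neq1 : zeta p != 1.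
Proof.
apply/negP; rewrite /zeta -/rho sqrf_eq1 => /orP[/eqP r1|/eqP r1].
  by have /eqP := rho_p; rewrite r1 expr1n -subr_eq0 opprK -mulr2n pnatr_eq0.
have [w wprim] := C_prim_root_exists p0.
have w1 : w != 1.
  by apply/negP => /eqP w1; have := prim_order_dvd wprim 1; rewrite w1 expr1n eqxx dvdn1 => /eqP p1; move: pr; rewrite p1.
have far (y : algC) : y ^+ p = -1 -> 0 <= 'Im y -> y = -1.
  move=> yp Imy; have := rootC_Re_max p0 yp Imy.
  rewrite -/rho r1 raddfN /= (Creal_ReP 1 _) ?rpred1 // => Rey.
  have ny : `|y| = 1.
    by apply/eqP; rewrite -(@pexpr_eq1 _ _ p) // -normrX yp normrN normr1.
  have : `|y + 1| ^+ 2 <= 0.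
    have -> : `|y + 1| ^+ 2 = 2 + 2 * 'Re y.
      rewrite normCK rmorphD rmorph1 /= mulrDl !mulrDr !mul1r !mulr1.
      by rewrite -normCK ny expr1n ReE mulrCA divff ?mulr1 ?pnatr_eq0 //; ring.
    rewrite -[X in X + _]mulr1 -mulrDr pmulr_rle0 ?ltr0n //.
    by rewrite -lerBrDl sub0r.
  rewrite real_exprn_even_le0 ?normr_real //= => /eqP/normr0_eq0 h.
  by apply/eqP; rewrite -subr_eq0 opprK h.
have wp : (- w) ^+ p = -1 by rewrite exprNn (prim_expr_order wprim) mulr1 -signr_odd podd.
have w1' y : y = -1 -> (y = - w) \/ (y = (- w)^*) -> False.
  move=> -> [/oppr_inj e|e]; first by rewrite -e eqxx in w1.
  have /oppr_inj e' : - w = -1 by rewrite -[- w]conjCK -e rmorphN1.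
  by rewrite e' eqxx in w1.
have : 'Im (- w) \is Num.real by apply: Creal_Im.
case/real_ge0P=> [Im0|Im0]; first by apply: (w1' (- w)) => //; [apply: far|left].
apply: (w1' ((- w)^*)); last by right.
by apply: far; rewrite ?Im_conj ?oppr_ge0 ?ltW // -rmorphXn wp rmorphN1.
Qed.

Lemma zeta_eq1 n : (zeta p ^+ n == 1) = (p %| n)%N.
Proof.
have [m mprim mp] := prim_order_exists p0 zeta_expp.
rewrite -(prim_order_dvd mprim); case/primeP: pr => _ /(_ _ mp)/orP[/eqP m1|/eqP -> //].
by have := prim_order_dvd mprim 1; rewrite m1 dvdnn expr1 (negPf zeta_neq1).
Qed.

End Zeta.

(** * The character of F defined by [zeta p] and the trace *)

Section TraceCharacter.
Variables (F : finFieldType) (p e : nat).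
Hypotheses (pr : prime p) (podd : odd p) (cF : #|F| = (p ^ e)%N).

Let pF : p \in [pchar F]. Proof. exact: card_finPcharP cF pr. Qed.

(** The default 0 of [Fp_rep] is not reached: otherwise b and the p elements of the prime field
    would be p + 1 roots of X^p - X. *)
Lemma Fp_repP (b : F) : b ^+ p = b -> (Fp_rep p b)%:R = b.
Proof.
move=> bp; rewrite /Fp_rep; case: pickP => [n /eqP //|nb] /=.
pose q : {poly F} := 'X^p - 'X.
have szq : size q = p.+1.
  by rewrite /q size_polyDl size_polyXn // size_polyN size_polyX ltnS prime_gt1.
pose s := b :: [seq (val i)%:R | i <- enum 'I_p].
have : (size s < size q)%N.
  apply: max_poly_roots; first by rewrite -size_poly_gt0 szq.
    apply/allP => x; rewrite inE /root /q !hornerE => /orP[/eqP ->|/mapP[i _ ->]].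
      by rewrite bp subrr.
    by rewrite -[_ ^+ p]/(pFrobenius_aut pF _) pFrobenius_aut_nat subrr.
  rewrite /= map_inj_uniq ?enum_uniq ?andbT.
    by apply/mapP => -[i _ bi]; have := nb i; rewrite /= bi eqxx.
  move=> i j; wlog ij : i j / (i <= j)%N.
    by move=> W h; case: (leqP i j) => [|/ltnW] ij; [|symmetry]; apply: W.
  move=> /esym/eqP; rewrite -subr_eq0 -natrB // -(dvdn_pcharf pF) => dv.
  apply/val_inj/eqP; rewrite eqn_leq ij leqNgt; apply/negP => h.
  have := dvdn_leq (_ : 0 < j - i)%N dv; rewrite subn_gt0 => /(_ h).
  by rewrite leqNgt (leq_ltn_trans (leq_subr _ _)).
by rewrite szq /= size_map size_enum_ord ltnn.
Qed.

Lemma zeta_natr m n : (m%:R : F) = n%:R -> zeta p ^+ m = zeta p ^+ n.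
Proof.
wlog mn : m n / (m <= n)%N.
  by move=> W h; case: (leqP m n) => [|/ltnW] ij; [|symmetry]; apply: W.
move=> /esym/eqP; rewrite -subr_eq0 -natrB // -(dvdn_pcharf pF).
by rewrite -(zeta_eq1 pr podd) -{2}(subnKC mn) exprD => /eqP ->; rewrite mulr1.
Qed.

Let TrD : {morph @Tr F p e : x y / x + y}.
Proof.
by move=> x y; rewrite /Tr -big_split; apply: eq_bigr => i _; rewrite frobD.
Qed.

Let Tr_frob (x : F) : Tr p e (x ^+ p) = Tr p e x.
Proof.
have xq : x ^+ (p ^ e) = x by rewrite -cF expf_card.
rewrite /Tr; case: (e) xq => [|n] xq; first by rewrite !big_ord0.
rewrite big_ord_recr /= -exprM -expnS xq [RHS]big_ord_recl expn0 expr1 addrC.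
by congr (_ + _); apply: eq_bigr => i _; rewrite -exprM -expnS.
Qed.

Let Tr_Fp (x : F) : (Tr p e x) ^+ p = Tr p e x.
Proof.
rewrite -[RHS]Tr_frob /Tr -[X in _ ^+ X]expn1 (frob_sum 1 _ _ _ pF).
by apply: eq_bigr => i _; rewrite expn1 -!exprM mulnC.
Qed.

Definition zeta_Tr (x : F) : algC := zeta p ^+ Fp_rep p (Tr p e x).

Lemma trace_char_zeta : trace_char p zeta_Tr.
Proof.
have repP x := Fp_repP (Tr_Fp x); split.
- rewrite /zeta_Tr -[RHS](expr0 (zeta p)); apply: zeta_natr; rewrite repP.
  by have /eqP := TrD 0 0; rewrite addr0 -subr_eq0 opprD addNKr oppr_eq0 => /eqP.
- move=> x y; rewrite /zeta_Tr -exprD; apply: zeta_natr.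
  by rewrite natrD !repP TrD.
- by move=> x; rewrite /zeta_Tr Tr_frob.
(* The trace is a polynomial of degree below |F| with coefficient 1 at X, so it cannot vanish
   everywhere. *)
have [x Tx] : exists x : F, Tr p e x != 0.
  apply/existsP; apply: contraT; rewrite negb_exists => /forallP T0.
  have e0 : (0 < e)%N.
    by case: (e) cF => // c; have := finNzRing_gt1 F; rewrite c.
  pose q : {poly F} := \sum_(j < e) 'X^(p ^ j).
  have q0 : q != 0.
    apply: contraTneq isT => /(congr1 (fun r : {poly F} => r`_1)).
    rewrite /q coef0 coef_sum; case: (e) e0 => // n _.
    rewrite big_ord_recl expn0 coefXn eqxx big1 ?addr0 => [/eqP|i _]; first by rewrite oner_eq0.
    by rewrite coefXn eq_sym gtn_eqF // -{1}(expn0 p) ltn_exp2l ?prime_gt1.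
  have : (size (enum F) < size q)%N.
    apply: max_poly_roots; rewrite ?enum_uniq //; apply/allP => x _.
    apply/eqP; have /negbNE/eqP T0x := T0 x; rewrite /q horner_sum -[RHS]T0x.
    by apply: eq_bigr => i _; rewrite hornerXn.
  rewrite -cardE cF ltnNge => /negP[].
  apply: leq_trans (size_sum _ _ _) _; apply/bigmax_leqP => i _.
  by rewrite size_polyXn ltn_exp2l ?prime_gt1.
exists x; rewrite /zeta_Tr zeta_eq1 // (dvdn_pcharf pF) repP //.
Qed.

Lemma expsumE (a b : F) : expsum p e (a *: 'X^3 + b *: 'X) = cubic_sum zeta_Tr a b.
Proof.
rewrite /expsum /cubic_sum; apply: eq_bigr => x _.
by rewrite /zeta_Tr !(hornerD, hornerZ, hornerXn, hornerX).
Qed.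

End TraceCharacter.

(** * Maxima of real elements in the partially ordered field [algC] *)

Section RealBigmax.
Variables (I : finType) (P : pred I) (f : I -> algC) (x0 : algC).

Lemma bigmax_Creal : x0 \is Num.real -> (forall i, P i -> f i \is Num.real) ->
  \big[Num.max/x0]_(i | P i) f i \is Num.real.
Proof. by move=> x0r fr; elim/big_ind: _ => // x y; apply: max_real. Qed.

Lemma bigmax_Cle B : x0 <= B -> (forall i, P i -> f i <= B) ->
  \big[Num.max/x0]_(i | P i) f i <= B.
Proof. by move=> x0B fB; elim/big_ind: _ => // x y xB yB; rewrite /Order.max; case: ifP. Qed.

Lemma le_bigmax_C i : x0 \is Num.real -> (forall i, P i -> f i \is Num.real) ->
  P i -> f i <= \big[Num.max/x0]_(i | P i) f i.
Proof.
move=> x0r fr Pi; rewrite unlock /=; elim: index_enum (mem_index_enum i) => //= j s IH.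
have sr : reducebig x0 s (fun i => BigBody i Num.max (P i) (f i)) \is Num.real.
  by elim: s {IH} => //= k s IH; case: ifP => // Pk; apply: max_real => //; apply: fr.
rewrite inE => /predU1P[<-|/IH le_s].
  by rewrite Pi comparable_le_max ?lexx // real_comparable ?fr.
case: ifP => // Pj; rewrite comparable_le_max ?le_s ?orbT // real_comparable ?fr //.
Qed.

End RealBigmax.

(** * The second eigenvalue of a diagonalized matrix *)

Section Spectrum.
Variables (n : nat) (A P : 'M[algC]_n) (d : 'rV[algC]_n).
Hypotheses (PU : P \in unitmx) (PA : P *m A = diag_mx d *m P).

Lemma char_poly_diagonalized : char_poly A = \prod_i ('X - (d 0 i)%:P).
Proof.
transitivity (char_poly (diag_mx d)); last first.
  rewrite char_poly_trig ?diag_mx_is_trig //.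
  by apply: eq_bigr => i _; rewrite mxE eqxx.
have dP : \det (map_mx polyC P) != 0.
  by rewrite det_map_mx polyC_eq0 -unitfE -unitmxE.
apply: (mulfI dP); rewrite /char_poly -det_mulmx mulrC -det_mulmx.
congr (\det _); rewrite /char_poly_mx mulmxBr mulmxBl scalar_mxC.
by rewrite -!map_mxM /= PA.
Qed.

Lemma perm_eigvals : perm_eq (eigvals A) [seq d 0 i | i <- enum 'I_n].
Proof.
rewrite /eigvals; case: closed_field_poly_normal => r /= rE.
apply: (@perm_trans _ r); first by rewrite perm_sort.
apply: prod_XsubC_eq; rewrite big_map big_enum /= -char_poly_diagonalized rE.
by rewrite (monicP (char_poly_monic A)) scale1r.
Qed.

(** At most one eigenvalue, counted with multiplicity, can exceed B. In the decreasing list a second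
    entry above B would put the first above B too. Realness makes the sorting order total on the
    spectrum. *)
Lemma lambda2_le (i0 : 'I_n) (B : algC) :
  (forall i, d 0 i \is Num.real) -> B \is Num.real ->
  (forall i, i != i0 -> d 0 i <= B) -> (1 < n)%N -> lambda2 A <= B.
Proof.
move=> dr Br dB n1; have pe := perm_eigvals.
have sr : all (fun x => x \is Num.real) (eigvals A).
  by rewrite (perm_all _ pe); apply/allP => _ /mapP[i _ ->].
have ss : sorted (fun x y : algC => y <= x) (eigvals A).
  have tot : {in Num.real &, total (fun x y : algC => y <= x)}.
    by move=> x y xr yr; rewrite orbC; apply: real_leVge.
  apply: (sort_sorted_in tot); move: sr; rewrite /eigvals.
  by rewrite (perm_all _ (permEl (perm_sort _ _))).
have cnt : (count (fun x : algC => ~~ (x <= B)%R) (eigvals A) <= 1)%N.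
  rewrite (permP pe) count_map -size_filter; apply: (@uniq_leq_size _ _ [:: i0]).
    by rewrite filter_uniq ?enum_uniq.
  move=> i; rewrite mem_filter /= mem_seq1 => /andP[h _].
  by apply: contraR h; apply: dB.
have sz : size (eigvals A) = n by rewrite (perm_size pe) size_map size_enum_ord.
rewrite /lambda2; move: sr ss cnt sz.
(* Since n > 1, the list has two entries and [nth] does not return its default. *)
case: (eigvals A) => [|x [|y s]] /=; try by move=> *; lia.
move=> /and3P[xr yr _] /andP[yx _] cnt _.
rewrite real_leNgt //; apply/negP => By; move: cnt.
by rewrite -!real_ltNge // By (lt_le_trans By yx).
Qed.
End Spectrum.

(** * The graph as a Cayley graph *)

Section Graph.
Variables (F : finFieldType) (p k : nat).
Hypothesis k3 : (3 <= k)%N.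

Let T := (k.-tuple F : finType).
Let S := @S_adj F k (fun i => 'X^(p ^ (i - 2))) (fun _ => 'X^3).

(* The connection set of the Cayley graph S(k,q), with w = (b_2 - a_2) / (b_1 - a_1). *)
Definition S_step (u w : F) (i : nat) : F :=
  if i is 0 then u else if i is 1 then u * w else u ^+ 3 * w ^+ (p ^ i.-1).

Definition S_shift (b : T) (uw : F * F) : T :=
  [tuple b`_i - S_step uw.1 uw.2 i | i < k].

Let k0 : (0 < k)%N. Proof. by lia. Qed.
Let k1 : (1 < k)%N. Proof. by lia. Qed.

Let nth_shift b uw i : (i < k)%N -> (S_shift b uw)`_i = b`_i - S_step uw.1 uw.2 i.
Proof.
by move=> ik; rewrite -[i in LHS]/(val (Ordinal ik)) -tnth_nth tnth_mktuple.
Qed.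

Let S_stepE (a b : T) : S a b = [forall i : 'I_k,
    (a`_0 != b`_0) && (b`_i - a`_i == S_step (b`_0 - a`_0) ((b`_1 - a`_1) / (b`_0 - a`_0)) i)].
Proof.
rewrite /S /S_adj; apply/andP/forallP => [[ab /forallP H] i|H].
  rewrite ab /=; have ba : b`_0 - a`_0 != 0 by rewrite subr_eq0 eq_sym.
  case: i => -[|[|i]] ik //=; first by rewrite mulrC divfK.
  by have := H (Ordinal ik); rewrite !hornerXn subSS subn1.
split; first by have /andP[] := H (Ordinal k0).
apply/forallP => -[[|[|i]] ik] //=.
by have /andP[_] := H (Ordinal ik); rewrite !hornerXn subSS subn1.
Qed.

(** For fixed w every coordinate is odd in u, so negating u reverses an edge. *)
Lemma S_step_opp u w i : S_step (- u) w i = - S_step u w i.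
Proof. by case: i => [|[|i]] //=; rewrite ?mulNr //; ring. Qed.

Lemma S_adj_sym : symmetric S.
Proof.
suff H a b : S a b -> S b a by move=> a b; apply/idP/idP; apply: H.
rewrite !S_stepE => /forallP H; apply/forallP => i; have /andP[ab /eqP h] := H i.
rewrite eq_sym ab /=; have -> : (a`_1 - b`_1) / (a`_0 - b`_0) = (b`_1 - a`_1) / (b`_0 - a`_0).
  by rewrite -[a`_1 - _]opprB -[a`_0 - _]opprB invrN mulrNN.
by rewrite -[a`_i - _]opprB -[a`_0 - _]opprB S_step_opp h.
Qed.

Lemma sum_S_adj (V : nmodType) (b : T) (G : T -> V) :
  \sum_(a | S a b) G a = \sum_(uw : F * F | uw.1 != 0) G (S_shift b uw).
Proof.
rewrite (reindex_onto (S_shift b)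
  (fun a => (b`_0 - a`_0, (b`_1 - a`_1) / (b`_0 - a`_0)))) => [|a].
  apply: eq_bigl => -[u w].
  move: (S_shift b (u, w)) (@nth_shift b (u, w)) => a nth_a /=.
  rewrite !nth_a //= !subKr.
  have [uz|u0] := eqVneq u 0.
    rewrite S_stepE; apply/negP => /andP[/forallP/(_ (Ordinal k0))/andP[]].
    by rewrite nth_a //= uz subr0 eqxx.
  rewrite mulrC mulKf // eqxx andbT S_stepE; apply/forallP => i.
  rewrite !nth_a //= !subKr mulrC mulKf // eqxx andbT.
  by rewrite -subr_eq0 addrAC subrr sub0r oppr_eq0.
rewrite S_stepE => /forallP H; apply: eq_from_tnth => i.
have /andP[ab /eqP h] := H i.
by rewrite tnth_mktuple -h (tnth_nth 0) opprB addrC subrK.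
Qed.

Lemma card_S_adj (b : T) : (\sum_(a | S a b) 1 = #|F| * #|F|.-1)%N.
Proof.
rewrite (sum_S_adj b (fun=> 1%N)) sum1dep_card.
rewrite -(cardC1 (0 : F)) mulnC -cardX; apply: eq_card => -[u w].
by rewrite !inE andbT.
Qed.

End Graph.

(** * Characters of F^k diagonalize the adjacency matrix *)

Section CayleyEigenvalues.
Variables (F : finFieldType) (p k : nat) (psi : F -> algC).
Hypotheses (k3 : (3 <= k)%N) (pF : p \in [pchar F]) (psiP : trace_char p psi).

Let T := (k.-tuple F : finType).
Let S := @S_adj F k (fun i => 'X^(p ^ (i - 2))) (fun _ => 'X^3).
Let psi0 : psi 0 = 1. Proof. by case: psiP. Qed.
Let psiD : {morph psi : x y / x + y >-> x * y}. Proof. by case: psiP. Qed.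

(** Vectors are functions on nat, so that tuples, through [co], and [S_step] can be paired alike. *)
Definition dot (c : nat -> F) (a : nat -> F) : F := \sum_(i < k) c i * a i.

Let dotDr c a a' : dot c (fun i => a i + a' i) = dot c a + dot c a'.
Proof. by rewrite /dot -big_split; apply: eq_bigr => i _; rewrite mulrDr. Qed.

Let dotNr c a : dot c (fun i => - a i) = - dot c a.
Proof. by rewrite /dot -sumrN; apply: eq_bigr => i _; rewrite mulrN. Qed.

Let dotBl c c' a : dot (fun i => c i - c' i) a = dot c a - dot c' a.
Proof. by rewrite /dot -sumrB; apply: eq_bigr => i _; rewrite mulrBl. Qed.

Let co (a : T) (i : nat) : F := a`_i.

(** If c_i is nonzero, translating coordinate i by x0 / c_i multiplies the sum by psi x0, which is
    not 1. *)
Lemma sum_psi_dot (c : nat -> F) :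
  \sum_(a : T) psi (dot c (co a)) = #|T|%:R * [forall i : 'I_k, c i == 0]%:R.
Proof.
case: forallP => [c0|/forallP].
  rewrite (eq_bigr (fun=> 1)) ?sumr_const ?mulr1 // => a _.
  by rewrite /dot big1 ?psi0 // => i _; rewrite (eqP (c0 i)) mul0r.
rewrite negb_forall => /existsP[i ci]; rewrite mulr0.
have [_ _ _ [x0 x01]] := psiP.
pose sh (a : T) : T := [tuple co a j + (if j == i then x0 / c i else 0) | j < k].
have sh_inj : injective sh.
  move=> a b e; apply: eq_from_tnth => j; rewrite !(tnth_nth 0).
  by have := congr1 (fun t : T => tnth t j) e; rewrite !tnth_mktuple => /addIr.
have shE a : psi (dot c (co (sh a))) = psi x0 * psi (dot c (co a)).
  rewrite -psiD; congr psi.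
  have -> : dot c (co (sh a)) = dot c (fun j => co a j + (if j == i :> nat then x0 / c i else 0)).
    by apply: eq_bigr => j _; rewrite /co -tnth_nth tnth_mktuple.
  rewrite dotDr addrC; congr (_ + _); rewrite /dot (bigD1 i) //= eqxx.
  rewrite mulrC divfK // big1 ?addr0 // => j ji.
  by rewrite (inj_eq val_inj) (negPf ji) mulr0.
apply/eqP; have /eqP : psi x0 * \sum_(a : T) psi (dot c (co a)) = \sum_(a : T) psi (dot c (co a)).
  by rewrite mulr_sumr [RHS](reindex_inj sh_inj); apply: eq_bigr => a _; rewrite shE.
by rewrite -subr_eq0 -{2}[\sum_a _]mul1r -mulrBl mulf_eq0 subr_eq0 (negPf x01).
Qed.

Let n := #|T|.
Let n0 : (n%:R : algC) != 0.
Proof. by rewrite pnatr_eq0 -lt0n; apply/card_gt0P; exists [tuple of nseq k 0]. Qed.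

Definition chi_mx : 'M[algC]_n :=
  \matrix_(i, j) psi (- dot (co (enum_val i)) (co (enum_val j))).

Lemma sum_enum_val (V : nmodType) (G : T -> V) :
  \sum_(i < n) G (enum_val i) = \sum_(a : T) G a.
Proof. by rewrite [RHS](reindex (@enum_val T T)) //; apply/onW_bij/enum_val_bij. Qed.

Lemma chi_mx_unit : chi_mx \in unitmx.
Proof.
pose Q : 'M[algC]_n := \matrix_(i, j) psi (dot (co (enum_val j)) (co (enum_val i))).
suff : chi_mx *m (n%:R^-1 *: Q) = 1%:M by case/mulmx1_unit.
apply/matrixP => i j; rewrite -scalemxAr !mxE.
under eq_bigr => m _ do rewrite !mxE -psiD addrC -dotBl.
rewrite (sum_enum_val (fun a => psi (dot _ (co a)))) sum_psi_dot mulrA mulVf // mul1r.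
congr ((nat_of_bool _)%:R); apply/forallP/eqP => [h|-> l]; last by rewrite subrr.
apply: enum_val_inj; apply: eq_from_tnth => l.
by rewrite !(tnth_nth 0); apply/esym/eqP; rewrite -subr_eq0 h.
Qed.

Definition lam (c : T) : algC :=
  \sum_(uw : F * F | uw.1 != 0) psi (dot (co c) (S_step p uw.1 uw.2)).

(** Passing from b to its neighbour b - step multiplies the character value by psi of the pairing of
    c with the step, a factor independent of b. *)
Lemma chi_mx_adj : chi_mx *m adj_mx S = diag_mx (\row_i lam (enum_val i)) *m chi_mx.
Proof.
apply/matrixP => i j; rewrite mul_diag_mx !mxE.
under eq_bigr => m _ do rewrite !mxE.
set c := enum_val i; set b := enum_val j.
rewrite (sum_enum_val (fun a => psi (- dot (co c) (co a)) * (S a b)%:R)).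
under eq_bigr => a _ do rewrite mulr_natr mulrb.
rewrite -big_mkcond /= (sum_S_adj p k3 b) mulr_suml; apply: eq_bigr => uw _.
rewrite -psiD -dotNr -[- dot (co c) (co b)]dotNr -dotDr; congr psi; apply: eq_bigr => l _.
have -> : co (S_shift p b uw) l = co b l - S_step p uw.1 uw.2 l.
  by rewrite /co -[LHS]tnth_nth tnth_mktuple.
by ring.
Qed.

Definition cubic_coef (c : T) (w : F) : F := \sum_(i < k | (2 <= i)%N) c`_i * w ^+ (p ^ i.-1).

Lemma lamE (c : T) :
  lam c = \sum_w (cubic_sum psi (cubic_coef c w) (c`_0 + c`_1 * w) - 1).
Proof.
have dotE u w : dot (co c) (S_step p u w) = cubic_coef c w * u ^+ 3 + (c`_0 + c`_1 * w) * u.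
  have kk : k = (k - 2).+2 by lia.
  have E (f : nat -> F) : \sum_(i < k) f i = f 0%N + f 1%N + \sum_(i < k | (2 <= i)%N) f i.
    rewrite (bigD1 (Ordinal (ltnW (ltnW k3)))) //= (bigD1 (Ordinal (ltnW k3))) //= addrA.
    by congr (_ + _); apply: eq_bigl => -[[|[|i]] ik].
  rewrite /dot (E (fun i => co c i * S_step p u w i)) /= addrC; congr (_ + _).
    rewrite /cubic_coef mulr_suml; apply: eq_bigr => -[[|[|i]] ik] //= _.
    by rewrite /co; ring.
  by rewrite /co; ring.
transitivity (\sum_(u | u != 0) \sum_w psi (dot (co c) (S_step p u w))).
  by rewrite pair_big /lam; apply: eq_bigl => uw; rewrite andbT.
rewrite exchange_big; apply: eq_bigr => w _.
(* The subtracted 1 is the term u = 0 missing from the connection set. *)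
rewrite /cubic_sum [X in X - 1](bigD1 0) //= expr0n /= !mulr0 addr0 psi0 addrAC subrr add0r.
by apply: eq_bigr => u _; rewrite dotE.
Qed.

Lemma lam_real c : lam c \is Num.real.
Proof.
by rewrite lamE rpred_sum // => w _; rewrite rpredB ?rpred1 // (cubic_sum_real pF psiP).
Qed.

End CayleyEigenvalues.

(** * Bounding the nontrivial eigenvalues *)

Section Bound.
Variables (F : finFieldType) (p k : nat) (psi : F -> algC) (M : algC).
Hypotheses (k3 : (3 <= k)%N) (pF : p \in [pchar F]) (psiP : trace_char p psi).
Hypothesis cube_inj : injective (fun x : F => x ^+ 3).
Hypotheses (Mr : M \is Num.real) (M0 : 0 <= M).
Hypothesis cubic_le : forall a b : F, a != 0 -> b != 0 -> cubic_sum psi a b <= M.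

Let T := (k.-tuple F : finType).
Let S := @S_adj F k (fun i => 'X^(p ^ (i - 2))) (fun _ => 'X^3).
Let n := #|T|.
Let q := #|F|.
Let zero : T := [tuple of nseq k 0].
Let pr : prime p. Proof. exact: pcharf_prime pF. Qed.
Let q0 : (0 < q)%N. Proof. by apply/card_gt0P; exists 0. Qed.

Let cubic_sum_a0 a : cubic_sum psi a 0 = q%:R * (a == 0)%:R.
Proof.
rewrite -(char_sumM psiP) [RHS](reindex_inj cube_inj) /cubic_sum.
by apply: eq_bigr => x _; rewrite mul0r addr0.
Qed.

Let cubic_sum_0b b : cubic_sum psi 0 b = q%:R * (b == 0)%:R.
Proof.
by rewrite -(char_sumM psiP); apply: eq_bigr => x _; rewrite mul0r add0r.
Qed.

Let B : algC := Num.max (q * (p ^ (k - 3) - 1))%N%:R ((q - 1)%N%:R * M).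

Lemma eigen_bound_real : B \is Num.real.
Proof. by apply: max_real; rewrite ?realn ?rpredM ?realn. Qed.

(** All exponents of [cubic_coef] are divisible by p, so it equals Q(w^p) with Q of degree at most
    p^(k-3). As Frobenius is injective, this saves a factor p over the naive degree p^(k-2). *)
Lemma card_cubic_coef0 (c : T) i : (2 <= i < k)%N -> c`_i != 0 ->
  (#|[set w | cubic_coef p c w == 0%R]| <= p ^ (k - 3))%N.
Proof.
move=> /andP[i2 ik] ci; set Z := [set w | _].
pose Q : {poly F} := \sum_(j < k | (2 <= j)%N) c`_j *: 'X^(p ^ (j - 2)).
have QE w : Q.[w ^+ p] = cubic_coef p c w.
  rewrite /Q horner_sum; apply: eq_bigr => -[j jk] /= j2.
  by rewrite hornerZ hornerXn -exprM -expnS; congr (_ * _ ^+ (p ^ _)); lia.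
have Q0 : Q != 0.
  apply: contraNneq ci => /(congr1 (fun r : {poly F} => r`_(p ^ (i - 2)))).
  rewrite /Q coef0 coef_sum (bigD1 (Ordinal ik)) //= coefZ coefXn eqxx mulr1.
  rewrite big1 ?addr0 => [->|[j jk] /= /andP[j2 ji]]; first exact: eqxx.
  rewrite coefZ coefXn eqn_exp2l ?prime_gt1 //= (_ : (_ == _)%N = false) ?mulr0 //.
  apply/negP => /eqP ij; case/eqP: ji; apply: val_inj => /=; lia.
have : (size [seq w ^+ p | w <- enum Z] < size Q)%N.
  apply: max_poly_roots => //.
    by apply/allP => x /mapP[w wZ ->]; move: wZ; rewrite mem_enum inE /root QE.
  rewrite map_inj_uniq ?enum_uniq //; apply: (fmorph_inj (pFrobenius_aut pF)).
rewrite size_map -cardE => /leq_trans h; rewrite -ltnS; apply: h.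
apply: leq_trans (size_sum _ _ _) _; apply/bigmax_leqP => -[j jk] /= j2.
apply: leq_trans (size_scale_leq _ _) _; rewrite size_polyXn ltnS leq_exp2l ?prime_gt1 //.
lia.
Qed.

(** Write A(w) for [cubic_coef] and B(w) = c_0 + c_1 w. If B is identically zero, each zero of A
    contributes q and the other w nothing. Otherwise B has at most one zero, and its contribution q
    is absorbed by the total -q of the subtracted ones. *)
Lemma lam_le (c : T) : c != zero -> lam p psi c <= B.
Proof.
move=> c0; have Bl : (q * (p ^ (k - 3) - 1))%N%:R <= B.
  by rewrite comparable_le_max ?lexx // real_comparable ?rpredM ?realn.
have Br : (q - 1)%N%:R * M <= B.
  by rewrite comparable_le_max ?lexx ?orbT // real_comparable ?rpredM ?realn.
have [i ci] : exists i : 'I_k, c`_i != 0.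
  apply/existsP; apply: contraR c0; rewrite negb_exists => /forallP h.
  apply/eqP/eq_from_tnth => i; rewrite !(tnth_nth 0) nth_nseq ltn_ord.
  by apply/eqP; rewrite -[_ == _]negbK h.
rewrite lamE // sumrB sumr_const -/q.
have [/andP[/eqP c00 /eqP c10]|c01] := boolP ((c`_0 == 0) && (c`_1 == 0)).
  apply: le_trans Bl; have i2 : (2 <= i)%N.
    by case: i ci => -[|[|i]] ik //=; rewrite ?c00 ?c10 eqxx.
  have cZ := @card_cubic_coef0 c i _ ci; rewrite i2 ltn_ord in cZ.
  under eq_bigr => w _ do rewrite c00 c10 mul0r addr0 cubic_sum_a0.
  rewrite -mulr_sumr -natr_sum (_ : (\sum_w _)%N = #|[set w | cubic_coef p c w == 0]|); last first.
    by rewrite -sum1dep_card [RHS]big_mkcond.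
  rewrite -[X in _ - X]mulr1 -mulrBr natrM ler_wpM2l ?ler0n //.
  by rewrite natrB ?expn_gt0 ?prime_gt0 // lerD2r ler_nat; apply: cZ.
apply: le_trans Br.
(* Since A(0) = 0, the value w = 0 never contributes M; hence the factor q - 1. *)
have key w : cubic_sum psi (cubic_coef p c w) (c`_0 + c`_1 * w) <=
    q%:R * (c`_0 + c`_1 * w == 0)%:R + M * (w != 0)%:R.
  have Mw : 0 <= M * (w != 0)%:R by rewrite mulr_ge0 ?ler0n.
  have qw : 0 <= q%:R * (c`_0 + c`_1 * w == 0)%:R :> algC by rewrite mulr_ge0 ?ler0n.
  have [->|A0] := eqVneq (cubic_coef p c w) 0; first by rewrite cubic_sum_0b lerDl.
  have [->|B0] := eqVneq (c`_0 + c`_1 * w) 0.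
    by rewrite cubic_sum_a0 (negPf A0) mulr0 addr_ge0 // mulr_ge0 ?ler0n.
  rewrite mulr0 add0r; have -> : w != 0.
    apply: contraNneq A0 => ->; rewrite /cubic_coef big1 // => j j2.
    by rewrite expr0n expn_eq0 (gtn_eqF (prime_gt0 pr)) mulr0.
  by rewrite mulr1 cubic_le.
apply: (@le_trans _ _ (\sum_w (q%:R * (c`_0 + c`_1 * w == 0)%:R + M * (w != 0)%:R) - q%:R)).
  by rewrite lerD2r; apply: ler_sum => w _; apply: key.
rewrite big_split /= -!mulr_sumr -!natr_sum.
have N1 : (\sum_(w : F) (w != 0%R) = q - 1)%N.
  by rewrite -big_mkcond sum1dep_card /q subn1 -(cardC1 (0 : F)); apply: eq_card => w; rewrite !inE.
have N0 : (\sum_(w : F) (c`_0 + c`_1 * w == 0)%R <= 1)%N.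
  rewrite -[leqLHS](_ : #|[set w | c`_0 + c`_1 * w == 0]| = _); last first.
    by rewrite -sum1dep_card [LHS]big_mkcond.
  have [c10|c1] := eqVneq c`_1 0.
    rewrite (_ : [set w | _] = set0) ?cards0 //; apply/setP => w.
    by move: c01; rewrite !inE c10 mul0r addr0 eqxx andbT => /negPf.
  apply: (@leq_trans #|[set - c`_0 / c`_1]|); last by rewrite cards1.
  apply/subset_leq_card/subsetP => w.
  by rewrite !inE addrC addr_eq0 => /eqP <-; rewrite mulrAC divff ?mul1r.
rewrite N1 [M * _]mulrC addrAC -{2}[q%:R]mulr1 -mulrBr gerDr.
by rewrite mulr_ge0_le0 ?ler0n // subr_le0 lern1.
Qed.

End Bound.

(** * Connectedness from the simplicity of the top eigenvalue *)

Section Connected.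
Variables (F : finFieldType) (p k : nat) (psi : F -> algC).
Hypotheses (k3 : (3 <= k)%N) (psiP : trace_char p psi).

Let T := (k.-tuple F : finType).
Let S := @S_adj F k (fun i => 'X^(p ^ (i - 2))) (fun _ => 'X^3).
Let n := #|T|.
Let deg := (#|F| * #|F|.-1)%N.
Let zero : T := [tuple of nseq k 0].
Let A := adj_mx S.
Let P := chi_mx k psi : 'M_n.

Hypothesis lam_neq : forall c : T, c != zero -> lam p psi c != deg%:R.

(** In the character basis A acts diagonally, so an eigenvector for the degree lives only on the
    zero parameter, where alone the eigenvalue can equal the degree. *)
Lemma top_eigenvector (v : 'cV[algC]_n) : A *m v = deg%:R *: v ->
  forall i, i != enum_rank zero -> (P *m v) i 0 = 0.
Proof.
move=> Av i i0; have := chi_mx_adj k3 psiP => /(congr1 (mulmx^~ v)).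
rewrite -!mulmxA -/A Av -scalemxAr => /matrixP/(_ i 0).
rewrite mul_diag_mx !mxE => /eqP; rewrite eq_sym -subr_eq0 -mulrBl mulf_eq0 subr_eq0.
case/orP => [/eqP e|/eqP //].
have ci : enum_val i != zero by apply: contra i0 => /eqP <-; rewrite enum_valK.
by move: (lam_neq ci); rewrite e eqxx.
Qed.

Lemma adj_invariant (g : T -> algC) : (forall x y, S x y -> g x = g y) ->
  A *m (\col_i g (enum_val i)) = deg%:R *: \col_i g (enum_val i).
Proof.
move=> gS; apply/matrixP => i j; rewrite !mxE.
under eq_bigr => m _ do rewrite !mxE.
set x := enum_val i; rewrite (sum_enum_val (fun y => (S x y)%:R * g y)).
rewrite /deg -(card_S_adj p k3 x) natr_sum mulr_suml [RHS]big_mkcond /=.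
apply: eq_bigr => y _; rewrite [S x y]S_adj_sym // -/S; have := gS y x.
by case: (S y x) => gyx; rewrite ?mul0r // gyx.
Qed.

(** The constant 1 and the indicator of the component of a are both eigenvectors for the degree,
    hence proportional. The indicator is therefore constant, and it is 1 at a. *)
Lemma S_connected a b : connect S a b.
Proof.
pose g (x : T) : algC := (connect S a x)%:R.
have gS x y : S x y -> g x = g y.
  move=> xy; congr ((nat_of_bool _)%:R); apply/idP/idP => h.
    exact: connect_trans h (connect1 xy).
  by apply: connect_trans h (connect1 _); rewrite /S S_adj_sym.
set one : 'cV[algC]_n := \col_i 1; set f : 'cV[algC]_n := \col_i g (enum_val i).
set i0 := enum_rank zero.
have P1 i : i != i0 -> (P *m one) i 0 = 0.
  exact: top_eigenvector (@adj_invariant (fun=> 1) (fun _ _ _ => erefl)) _.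
have Pf i : i != i0 -> (P *m f) i 0 = 0.
  exact: top_eigenvector (adj_invariant gS) _.
have PU : P \in unitmx := chi_mx_unit k psiP.
have Pinj (v : 'cV[algC]_n) : P *m v = 0 -> v = 0.
  by move=> Pv; rewrite -[v]mul1mx -(mulVmx PU) -mulmxA Pv mulmx0.
pose al := (P *m one) i0 0; pose be := (P *m f) i0 0.
have lin : al *: f - be *: one = 0.
  apply: Pinj; rewrite mulmxBr -!scalemxAr /al /be.
  move: (P *m f) (P *m one) Pf P1 => vf v1 vf0 v10.
  apply/matrixP => i j; rewrite ord1 !mxE; have [->|ii0] := eqVneq i i0.
    by rewrite mulrC subrr.
  by rewrite (vf0 _ ii0) (v10 _ ii0) !mulr0 subrr.
have al0 : al != 0.
  apply/negP => /eqP al0; have : one = 0.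
    apply: Pinj; apply/matrixP => i j; rewrite ord1 [RHS]mxE.
    by have [->|ii0] := eqVneq i i0; [exact: al0 | exact: P1].
  by move/matrixP => /(_ i0 0); rewrite !mxE => /eqP; rewrite oner_eq0.
have gE x : al * g x = be.
  by move/matrixP: lin => /(_ (enum_rank x) 0) /eqP; rewrite !mxE enum_rankK mulr1 subr_eq0 => /eqP.
have := gE b; rewrite -(gE a) => /(mulfI al0); rewrite /g connect0.
by case: (connect S a b) => // /eqP; rewrite eq_sym oner_eq0.
Qed.

End Connected.

(** * Properties of [Mq] and the final assembly *)

Lemma real_Mq (F : finFieldType) p e : prime p -> odd p -> #|F| = (p ^ e)%N ->
  Mq F p e \is Num.real.
Proof.
move=> pr po cF; have pF := card_finPcharP cF pr.
have er (a b : F) : expsum p e (a *: 'X^3 + b *: 'X) \is Num.real.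
  by rewrite expsumE; apply: cubic_sum_real pF (trace_char_zeta pr po cF) _ _.
(* The initial value of both maxima is the sum for a = b = 1. *)
have e1 : expsum p e ('X^3 + 'X : {poly F}) \is Num.real.
  by have := er 1 1; rewrite !scale1r.
by rewrite /Mq; do 2![apply: bigmax_Creal => // ? _].
Qed.

Lemma le_Mq (F : finFieldType) p e (a b : F) : prime p -> odd p -> #|F| = (p ^ e)%N ->
  a != 0 -> b != 0 -> cubic_sum (zeta_Tr p e) a b <= Mq F p e.
Proof.
move=> pr po cF a0 b0; have pF := card_finPcharP cF pr.
have er (c d : F) : expsum p e (c *: 'X^3 + d *: 'X) \is Num.real.
  by rewrite expsumE; apply: cubic_sum_real pF (trace_char_zeta pr po cF) _ _.
have e1 : expsum p e ('X^3 + 'X : {poly F}) \is Num.real.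
  by have := er 1 1; rewrite !scale1r.
rewrite -expsumE; pose row c := \big[Num.max/expsum p e ('X^3 + 'X : {poly F})]_(d : F | d != 0)
  expsum p e (c *: 'X^3 + d *: 'X).
apply: (@le_trans _ _ (row a)).
  exact: (le_bigmax_C (f := fun d => expsum p e (a *: 'X^3 + d *: 'X)) e1 (fun d _ => er a d) b0).
by apply: (le_bigmax_C (f := row) e1 _ a0) => c _; apply: bigmax_Creal.
Qed.

Lemma Mq_le (F : finFieldType) p e : prime p -> (3 < p)%N -> #|F| = (p ^ e)%N ->
  Mq F p e <= 2 * sqrtC #|F|%:R.
Proof.
move=> pr p3 cF; have pF := card_finPcharP cF pr.
have po : odd p by case: (even_prime pr) => // p2; move: p3; rewrite p2.
have le_e (a b : F) : a != 0 -> expsum p e (a *: 'X^3 + b *: 'X) <= 2 * sqrtC #|F|%:R.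
  by move=> a0; rewrite expsumE; apply: cubic_sum_weil pF (trace_char_zeta pr po cF) a0 cF.
have e1 : expsum p e ('X^3 + 'X : {poly F}) <= 2 * sqrtC #|F|%:R.
  by have := le_e 1 1 (oner_neq0 _); rewrite !scale1r.
by rewrite /Mq; apply: bigmax_Cle => // a a0; apply: bigmax_Cle => // b _; apply: le_e.
Qed.

(** The sums with a = 1 add up to q over all b, while b = 0 gives zero as cubing permutes F. If [Mq]
    were negative, the total could not be positive. *)
Lemma Mq_ge0 (F : finFieldType) p e : prime p -> odd p -> #|F| = (p ^ e)%N ->
  injective (fun x : F => x ^+ 3) -> 0 <= Mq F p e.
Proof.
move=> pr po cF ci; have pF := card_finPcharP cF pr.
have psiP := trace_char_zeta pr po cF; have [psi0 psiD _ _] := psiP.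
have Mr := real_Mq pr po cF.
rewrite real_leNgt ?real0 //; apply/negP => M0.
have total : \sum_(b : F) cubic_sum (zeta_Tr p e) 1 b = #|F|%:R.
  rewrite /cubic_sum exchange_big (bigD1 0) //= [X in _ + X]big1 ?addr0 => [|x x0].
    under eq_bigr do rewrite expr0n /= !mulr0 addr0 psi0.
    by rewrite sumr_const.
  under eq_bigr => b _ do rewrite psiD [b * x]mulrC.
  by rewrite -mulr_sumr (char_sumM psiP) (negPf x0) !mulr0.
have zero : cubic_sum (zeta_Tr p e) 1 (0 : F) = 0.
  transitivity (\sum_(y : F) zeta_Tr p e (1 * y)).
    rewrite [RHS](reindex_inj ci) /cubic_sum.
    by apply: eq_bigr => x _; rewrite mul0r addr0.
  by rewrite (char_sumM psiP) oner_eq0 mulr0.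
have : (#|F|%:R : algC) <= 0.
  rewrite -total (bigD1 0) //= zero add0r; apply: sumr_le0 => b b0.
  by apply: le_trans (ltW M0); apply: le_Mq => //; apply: oner_neq0.
by rewrite lern0 => /eqP cF0; have := finNzRing_gt1 F; rewrite cF0.
Qed.

Theorem theorem4 (p e : nat) (F : finFieldType) (k : nat) :
  prime p -> #|F| = (p ^ e)%N -> odd #|F| -> (#|F| %% 3 = 2)%N ->
  (3 <= k <= e + 2)%N ->
  let S := @S_adj F k (fun i => 'X^(p ^ (i - 2))) (fun _ => 'X^3) in
  (forall a b : k.-tuple F, connect S a b) /\
  lambda2 (adj_mx S) <=
    Num.max ((#|F| * (p ^ (k - 3) - 1))%N%:R)
            ((#|F| - 1)%N%:R * Mq F p e) /\
  Mq F p e <= 2 * sqrtC (#|F|%:R).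
Proof.
move=> pr cF oddF F3 /andP[k3 ke] S.
have pF := card_finPcharP cF pr.
have e0 : (0 < e)%N by lia.
have po : odd p by move: oddF; rewrite cF oddX => /orP[/eqP e00|//]; rewrite e00 in e0.
have p3 : (3 < p)%N.
  have p2 : p != 2%N by apply: contraTneq po => ->.
  have p3 : p != 3%N.
    by apply: contra_eqN F3 => /eqP pE; rewrite cF pE -(prednK e0) expnS modnMr.
  by have := prime_gt1 pr; lia.
have q5 : (5 <= #|F|)%N.
  have : (p ^ 1 <= #|F|)%N by rewrite cF leq_exp2l // prime_gt1.
  rewrite expn1; move: F3; case: (#|F|) => [|[|[|[|[|m]]]]] //=; lia.
(* With q = 3m + 2, the inverse exponent is 2m + 1, because 3(2m + 1) = q + (q - 1). *)
have cube_inj : injective (fun x : F => x ^+ 3).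
  pose m := (#|F| %/ 3)%N; apply: (can_inj (g := fun y => y ^+ (2 * m).+1)) => x.
  rewrite -exprM; have -> : (3 * (2 * m).+1 = #|F| + #|F|.-1)%N.
    have := divn_eq #|F| 3; rewrite F3 -/m; lia.
  by rewrite exprD expf_card -exprS prednK ?expf_card //; lia.
have psiP := trace_char_zeta pr po cF.
have M0 := Mq_ge0 pr po cF cube_inj; have Mr := real_Mq pr po cF.
have cubic_le a b := @le_Mq F p e a b pr po cF.
have Mle := Mq_le pr p3 cF.
have lamB := lam_le k3 pF psiP cube_inj Mr M0 cubic_le.
split; last split => //.
  apply: S_connected k3 psiP _ => c c0.
  (* Both terms of the maximum are below the degree q(q - 1): k <= e + 2 gives p^(k-3) < q, and q >=
     5 gives 2 sqrt q < q. *)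
  rewrite lt_eqF //; apply: le_lt_trans (lamB c c0) _.
  have pk : (p ^ (k - 3) - 1 < #|F|.-1)%N.
    have : (p ^ (k - 3) < #|F|)%N by rewrite cF ltn_exp2l ?prime_gt1 //; lia.
    have : (0 < p ^ (k - 3))%N by rewrite expn_gt0 prime_gt0.
    lia.
  have Mq_lt : Mq F p e < #|F|%:R.
    apply: le_lt_trans Mle _; rewrite -(@ltr_pXn2r _ 2) ?nnegrE ?ler0n //; last first.
      by rewrite mulr_ge0 ?sqrtC_ge0 ?ler0n.
    rewrite exprMn sqrtCK -[2]/(2%:R) -!natrX -natrM ltr_nat.
    by rewrite -[(#|F| ^ 2)%N]mulnn ltn_pmul2r (leq_trans _ q5).
  rewrite /Order.max; case: ifP => _.
    by rewrite natrM mulrC -subn1 ltr_pM2r // ltr0n subn_gt0 (leq_trans _ q5).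
  by rewrite ltr_nat ltn_pmul2l // (leq_trans _ q5).
apply: (lambda2_le (chi_mx_unit k psiP) (chi_mx_adj k3 psiP)
   (i0 := enum_rank [tuple of nseq k 0])).
- by move=> i; rewrite mxE (lam_real k3 pF psiP).
- exact: eigen_bound_real.
- move=> i i0; rewrite mxE; apply: lamB; apply: contra i0 => /eqP <-.
  by rewrite enum_valK.
- rewrite card_tuple; apply: (@leq_trans (#|F| ^ 1)%N); first by rewrite expn1; lia.
  by rewrite leq_exp2l; lia.
Qed.
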